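(* Suppose that for all strict partitions $\mu\subseteq\lambda$ one has $jq_{\lambda/\mu}=\sum_{T\in\mathrm{ShBT}_Q(\lambda/\mu)}(-\beta)^{|\lambda/\mu|-|T|}x^T$. Then $a^\lambda_{\mu\nu}=0$ for all strict partitions $\lambda,\mu,\nu$ with $\ell(\lambda)>\ell(\mu)+\ell(\nu)$. Likewise, if for all strict $\mu\subseteq\lambda$ one has $jp_{\lambda/\mu}=\sum_{T\in\mathrm{ShBT}_P(\lambda/\mu)}(-\beta)^{|\lambda/\mu|-|T|}x^T$, then $b^\lambda_{\mu\nu}=0$ whenever $\ell(\lambda)>\ell(\mu)+\ell(\nu)$.
   Context: A strict partition is a finite strictly decreasing sequence of positive integers (possibly empty), $\ell(\lambda)$ its number of parts, $|\lambda|=\sum\lambda_i$; $\mathsf{SD}_\lambda=\{(i,j)\in\mathbb{Z}^2:0<i\le j<i+\lambda_i\}$ (boxes $(j,j)$ diagonal); $\mu\subseteq\lambda$ means $\mu_i\le\lambda_i$ for all $i$; $\mathsf{SD}_{\lambda/\mu}=\mathsf{SD}_\lambda\setminus\mathsf{SD}_\mu$, $|\lambda/\mu|=|\mathsf{SD}_{\lambda/\mu}|$. Let $i'=i-\frac12$ ($1'<1<2'<2<\cdots$). A semistandard set-valued shifted tableau of shape $\lambda$ fills $\mathsf{SD}_\lambda$ by nonempty finite sets of positive half-integers, weakly increasing along rows and columns ($S\le S'$ iff $\max S\le\min S'$), no unprimed number in two boxes of a column, no primed number in two boxes of a row; $P$-type if no primed number in a diagonal box; $x^T=\prod x_i^{m_i}$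 ($m_i$ = total occurrences of $i$ or $i'$), $|T|$ = total number of elements; $GP_\lambda=\sum_{P\text{-type}}\beta^{|T|-|\lambda|}x^T$, $GQ_\lambda=\sum_T\beta^{|T|-|\lambda|}x^T$. Integers $a^\lambda_{\mu\nu},b^\lambda_{\mu\nu}$ are the unique integers with $GP_\mu GP_\nu=\sum_\lambda a^\lambda_{\mu\nu}\beta^{|\lambda|-|\mu|-|\nu|}GP_\lambda$ and $GQ_\mu GQ_\nu=\sum_\lambda b^\lambda_{\mu\nu}\beta^{|\lambda|-|\mu|-|\nu|}GQ_\lambda$. With $\overline{x}=\frac{-x}{1+\beta x}$, $gp_\lambda,gq_\lambda$ are the unique elements of $\mathbb{Z}[\beta][[x_1,x_2,\dots]]$ with $\sum_\lambda GQ_\lambda(x)gp_\lambda(y)=\sum_\lambda GP_\lambda(x)gq_\lambda(y)=\prod_{i,j}\frac{1-\overline{x_i}y_j}{1-x_iy_j}$; $gq_{\lambda/\mu}:=\sum_\nu a^\lambda_{\mu\nu}\beta^{|\lambda|-|\mu|-|\nu|}gq_\nu$, $gp_{\lambda/\mu}:=\sum_\nu b^\lambda_{\mu\nu}\beta^{|\lambda|-|\mu|-|\nu|}gp_\nu$. $\omega$ is the $\mathbb{Z}[\beta]$-linear map on linear combinations of Schur functions with $\omega(s_\lambda)=s_{\lambda^\top}$; $jp_{\lambda/\mu}:=\omega(gp_{\lambda/\mu})$, $jq_{\lambda/\mu}:=\omega(gq_{\lambda/\mu})$. A shifted bar tableau of shape $\lambda/\mu$ is a pair $T=(V,\Pi)$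 with $V$ a semistandard shifted tableau of shape $\lambda/\mu$ (filling of $\mathsf{SD}_{\lambda/\mu}$ by positive half-integers, rows and columns weakly increasing, no primed entry repeated in a row, no unprimed entry repeated in a column) and $\Pi$ a set partition of $\mathsf{SD}_{\lambda/\mu}$ into blocks, each a set of adjacent boxes within a single row or single column all containing the same entry of $V$. $\mathrm{ShBT}_Q(\lambda/\mu)$ is the set of these, $\mathrm{ShBT}_P(\lambda/\mu)$ those with no primed diagonal entry in $V$; $|T|=|\Pi|$ and $x^T=\prod x_i^{b_i}$ with $b_i$ the number of blocks whose $V$-entry is $i$ or $i'$. *)

(* Defs.v *)
From HB Require Import structures.
From mathcomp Require Import all_boot all_order all_algebra.
From mathcomp Require Import finmap.
From mathcomp Require Import boolp classical_sets fsbigop.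

Set Implicit Arguments.
Unset Strict Implicit.
Unset Printing Implicit Defensive.

Import GRing.Theory.

Local Open Scope fset_scope.
Local Open Scope classical_set_scope.
Local Open Scope ring_scope.

(** * Partitions and diagrams *)

Record strict_partition := StrictPartition {
  strict_parts :> seq nat;
  _ : sorted gtn strict_parts && (0%N \notin strict_parts) }.
HB.instance Definition _ := [isSub for strict_parts].
HB.instance Definition _ := [Choice of strict_partition by <:].

Record int_partition := IntPartition {
  parts :> seq nat;
  _ : sorted geq parts && (0%N \notin parts) }.
HB.instance Definition _ := [isSub for parts].
HB.instance Definition _ := [Choice of int_partition by <:].

(* Parts are numbered from 1. *)
Definition part (s : seq nat) (i : nat) : nat := nth 0%N s i.-1.

Definition part_sub (mu la : strict_partition) : Prop :=
  forall i, (0 < i)%N -> (part mu i <= part la i)%N.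

Definition conj_seq (s : seq nat) : seq nat :=
  mkseq (fun j => count (leq j.+1) s) (head 0%N s).

Lemma conj_seq_subproof (la : int_partition) :
  sorted geq (conj_seq la) && (0%N \notin conj_seq la).
Proof.
apply/andP; split.
  rewrite /conj_seq /mkseq; set n := head _ _; move: n => n.
  have: sorted leq (iota 0 n) by apply: iota_sorted.
  rewrite sorted_map; apply: sub_sorted => i j /= lij.
  by apply: sub_count => k /=; apply: leq_ltn_trans.
apply/negP => /mapP[j]; rewrite mem_iota /= add0n.
by case: la => -[|p s] //= _ ->.
Qed.

Definition conj_partition (la : int_partition) : int_partition :=
  IntPartition (conj_seq_subproof la).

Definition box := (nat * nat)%type.

Definition SD (la : strict_partition) : {fset box} :=
  [fset ((i, j) : nat * nat) | i in iota 1 (size la), j in iota i (part la i)].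

Lemma in_SD la i j :
  ((i, j) \in SD la) = [&& (0 < i)%N, (i <= j)%N & (j < i + part la i)%N].
Proof.
apply/imfset2P/and3P => [[i' /=]|[i0 lij ltj]].
  rewrite mem_iota => /andP[i0 _] [j' /=].
  by rewrite mem_iota => /andP[? ?] [-> ->].
exists i => /=; last by exists j => //=; rewrite mem_iota lij.
rewrite mem_iota i0 /= add1n ltnS leqNgt; apply/negP => lti.
by move: ltj; rewrite /part nth_default ?addn0 1?ltnNge ?lij //; case: (i) lti.
Qed.

Definition SDskew (la mu : strict_partition) : {fset box} :=
  (SD la `\` SD mu)%fset.

Definition YD (la : int_partition) : {fset box} :=
  [fset ((i, j) : nat * nat) | i in iota 1 (size la), j in iota 1 (part la i)].

(** * Power series in x_1, x_2, ... over Z[beta] *)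

Definition Zbeta := {poly int}.
Definition beta : Zbeta := 'X.

(* The variable x_(i+1) has index i; a monomial is its exponent vector. *)
Definition monom := {fsfun nat -> nat with 0%N}.

Definition series := monom -> Zbeta.

(* Sums [\sum_(_ \in _)] over infinite types are used below only where all but
   finitely many terms vanish: for a fixed monomial only finitely many
   tableaux contribute, and GP la, GQ la have no terms of degree < |la|. *)
Definition smul (f g : series) : series := fun m =>
  \sum_(p \in [set p : monom * monom | forall i, m i = (p.1 i + p.2 i)%N])
    f p.1 * g p.2.

(** * Set-valued shifted tableaux *)

(* The half-integer z is represented by 2z, i.e. i' by 2i-1 and i by 2i.  The
   variable attached to i' and to i is x_i, which has index i-1. *)
Definition primed (k : nat) : bool := odd k.
Definition var_index (k : nat) : nat := k.-1./2.

(* The default value fset0 makes [finsupp T = SD la] say that T assigns a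
   nonempty set to each box of SD la, and nothing elsewhere. *)
Definition sv_filling := {fsfun box -> {fset nat} with fset0}.

Definition set_le (S S' : {fset nat}) : Prop :=
  forall k k', k \in S -> k' \in S' -> (k <= k')%N.

Definition sv_tableau (la : strict_partition) (T : sv_filling) : Prop :=
  [/\ finsupp T = SD la,
      forall b, 0%N \notin T b,
      (forall i j j', (j < j')%N -> set_le (T (i, j)) (T (i, j'))) /\
      (forall i i' j, (i < i')%N -> set_le (T (i, j)) (T (i', j))),
      forall i i' j k, i <> i' ->
        k \in T (i, j) -> k \in T (i', j) -> primed k
    & forall i j j' k, j <> j' ->
        k \in T (i, j) -> k \in T (i, j') -> ~~ primed k].

Definition sv_Ptype (T : sv_filling) : Prop :=
  forall j k, k \in T (j, j) -> ~~ primed k.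

Definition sv_size (T : sv_filling) : nat :=
  (\sum_(b <- finsupp T) #|` T b|)%N.

Definition sv_weight (T : sv_filling) (m : monom) : Prop :=
  forall i, m i =
    (\sum_(b <- finsupp T) count (fun k => var_index k == i) (T b))%N.

Definition GQ (la : strict_partition) : series := fun m =>
  \sum_(T \in [set T | sv_tableau la T /\ sv_weight T m])
    beta ^+ (sv_size T - sumn la).

Definition GP (la : strict_partition) : series := fun m =>
  \sum_(T \in [set T | [/\ sv_tableau la T, sv_Ptype T & sv_weight T m]])
    beta ^+ (sv_size T - sumn la).

(* [c la mu nu] stands for the coefficient with superscript la and subscripts
   mu, nu.  The truncated subtraction is harmless: as G is GP or GQ, G la
   starts in degree |la| with a Schur P- or Q-function, so the identity forces
   c la mu nu = 0 when |la| < |mu| + |nu|. *)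
Definition structure_constants (G : strict_partition -> series)
    (c : strict_partition -> strict_partition -> strict_partition -> int) :=
  forall mu nu, smul (G mu) (G nu) =
    fun m => \sum_(la \in [set: strict_partition])
      (c la mu nu)%:~R * beta ^+ (sumn la - sumn mu - sumn nu) * G la m.

(** * The Cauchy kernel and the dual functions *)

(* Series in one x and one y: coefficient of x^p y^q. *)
Definition xyseries := nat -> nat -> Zbeta.

Definition xymul (f g : xyseries) : xyseries := fun p q =>
  \sum_(i < p.+1) \sum_(j < q.+1) f i j * g (p - i)%N (q - j)%N.

(* -x / (1 + beta x) = - x + beta x^2 - beta^2 x^3 + ... *)
Definition xbar (p : nat) : Zbeta :=
  if p is p'.+1 then - (- beta) ^+ p' else 0.

Lemma xbarP p : xbar p + (if p is p'.+1 then beta * xbar p' else 0) =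
  - (p == 1%N)%:R.
Proof.
case: p => [|[|p]] /=; first by rewrite addr0 oppr0.
  by rewrite mulr0 addr0 expr0.
by rewrite exprS mulrN !mulNr opprK subrr oppr0.
Qed.

(* (1 - xbar * y) * 1 / (1 - x * y) *)
Definition kernel_factor : xyseries :=
  xymul (fun p q => ((p == 0) && (q == 0))%N%:R - (q == 1%N)%:R * xbar p)
        (fun p q => (p == q)%:R).

(* Coefficient of x^m y^n in the product over all i, j of
   kernel_factor (x_i, y_j): since kernel_factor has constant term 1, expanding
   the product amounts to choosing exponents (p, q) for each of finitely many
   (i, j), and (0, 0) for all others. *)
Definition kernel (m n : monom) : Zbeta :=
  \sum_(E \in [set E : {fsfun nat * nat -> nat * nat with (0%N, 0%N)} |
      (forall i, m i = \sum_(ij <- finsupp E | ij.1 == i) (E ij).1)%N /\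
      (forall j, n j = \sum_(ij <- finsupp E | ij.2 == j) (E ij).2)%N])
    \prod_(ij <- finsupp E) kernel_factor (E ij).1 (E ij).2.

Definition cauchy_dual (G g : strict_partition -> series) : Prop :=
  forall m n : monom,
    \sum_(la \in [set: strict_partition]) G la m * g la n = kernel m n.

Definition skew_dual
    (c : strict_partition -> strict_partition -> strict_partition -> int)
    (g : strict_partition -> series) (la mu : strict_partition) : series :=
  fun m => \sum_(nu \in [set: strict_partition])
    (c la mu nu)%:~R * beta ^+ (sumn la - sumn mu - sumn nu) * g nu m.

(** * Schur functions and omega *)

(* Positive entries on the shape, 0 elsewhere. *)
Definition filling := {fsfun box -> nat with 0%N}.

Definition ssyt (la : int_partition) (T : filling) : Prop :=
  [/\ finsupp T = YD la,
      forall i j j', (i, j) \in YD la -> (i, j') \in YD la -> (j < j')%N ->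
        (T (i, j) <= T (i, j'))%N
    & forall i i' j, (i, j) \in YD la -> (i', j) \in YD la -> (i < i')%N ->
        (T (i, j) < T (i', j))%N].

Definition schur (la : int_partition) : series := fun m =>
  \sum_(T \in [set T : filling | ssyt la T /\
      forall i, m i = count (fun b => (T b).-1 == i) (finsupp T)]) (1 : Zbeta).

Definition omega_graph (f g : series) : Prop :=
  exists (s : seq int_partition) (c : int_partition -> Zbeta),
    f = (fun m => \sum_(la <- s) c la * schur la m) /\
    g = (fun m => \sum_(la <- s) c la * schur (conj_partition la) m).

(* Outside the span of the Schur functions omega takes the junk value 0. *)
Definition omega (f : series) : series :=
  xget (fun=> 0) [set g | omega_graph f g].

(** * Shifted bar tableaux *)

Definition shifted_tableau (la mu : strict_partition) (V : filling) : Prop :=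
  [/\ finsupp V = SDskew la mu,
      forall i j j', (i, j) \in SDskew la mu -> (i, j') \in SDskew la mu ->
        (j < j')%N -> (V (i, j) <= V (i, j'))%N,
      forall i i' j, (i, j) \in SDskew la mu -> (i', j) \in SDskew la mu ->
        (i < i')%N -> (V (i, j) <= V (i', j))%N,
      forall i j j', (i, j) \in SDskew la mu -> (i, j') \in SDskew la mu ->
        j <> j' -> V (i, j) = V (i, j') -> ~~ primed (V (i, j))
    & forall i i' j, (i, j) \in SDskew la mu -> (i', j) \in SDskew la mu ->
        i <> i' -> V (i, j) = V (i', j) -> primed (V (i, j))].

Definition set_partition (D : {fset box}) (P : {fset {fset box}}) : Prop :=
  [/\ fset0 \notin P, trivIfset P & fcover P = D].

Definition segment (B : {fset box}) : Prop :=
  exists i j n : nat,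
    B = [fset ((i, (j + t)%N) : nat * nat) | t in iota 0 n] \/
    B = [fset (((i + t)%N, j) : nat * nat) | t in iota 0 n].

Definition bar_filling := (filling * {fset {fset box}})%type.

Definition ShBTQ (la mu : strict_partition) (T : bar_filling) : Prop :=
  [/\ shifted_tableau la mu T.1,
      set_partition (SDskew la mu) T.2
    & forall B, B \in T.2 ->
        segment B /\ {in B &, forall b b', T.1 b = T.1 b'}].

Definition ShBTP (la mu : strict_partition) (T : bar_filling) : Prop :=
  ShBTQ la mu T /\
  forall j, (j, j) \in SDskew la mu -> ~~ primed (T.1 (j, j)).

(* V is constant on each (nonempty) block, so [has] reads off its value. *)
Definition bar_weight (T : bar_filling) (m : monom) : Prop :=
  forall i, m i =
    count (fun B : {fset box} => has (fun b => var_index (T.1 b) == i) B) T.2.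

Definition bar_series (S : set bar_filling) (la mu : strict_partition) :
    series := fun m =>
  \sum_(T \in S `&` [set T | bar_weight T m])
    (- beta) ^+ (#|` SDskew la mu| - #|` T.2|).

(* Main.v *)
Require Import Defs.
From HB Require Import structures.
From mathcomp Require Import all_boot all_order all_algebra.
From mathcomp Require Import finmap.
From mathcomp Require Import boolp classical_sets fsbigop.
From mathcomp Require Import cardinality.
From mathcomp Require Import zify.

(** Write [G] for [GP] or [GQ], [g] for the dual family and [J la] for the bar
    series of the straight shape [la], so that [J la = omega (g la)] by the
    hypothesis for [mu] empty.

    Expand the kernel as [K(x; y) = sum_rho c_rho(x) s_rho(y)], so that the
    series [W(x; y) := sum_la G_la(x) J_la(y)] is [sum_rho c_rho(x) s_rho'(y)].
    Adding one variable [t] to [y] acts on the [c_rho] through horizontal strips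
    in [K] and through vertical strips in [W], and these two operations are
    inverse to each other up to sign ([H(t) E(-t) = 1]).  As [K] is
    multiplicative in [y], each [y_j^k] in [K] contributes a factor [g_k(x)], so
    each [y_j^k] in [W] contributes a factor [f_k(x)]: [W] is multiplicative too.
    Comparing coefficients of [G_la(x)] in [W(x; y, z) = W(x; y) W(x; z)] gives
      [J_la(y, z) = sum_(mu, nu) a^la_(mu nu) beta^(..) J_mu(y) J_nu(z)].

    A box in row [i] of a straight shifted tableau carries a variable of index
    at least [i], so [J_la] vanishes in fewer than [l(la)] variables.  Taking
    [l(mu)] variables [y] and [l(nu)] variables [z] makes the left side [0] when
    [l(la) > l(mu) + l(nu)], while the [J_mu] with at most [p] parts remain
    linearly independent in [p] variables; hence [a^la_(mu nu) = 0]. *)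

Set Implicit Arguments.
Unset Strict Implicit.
Unset Printing Implicit Defensive.

Import GRing.Theory.

Local Open Scope classical_set_scope.
Local Open Scope ring_scope.

(** * Finite sums *)

Lemma finite_fsfun (K V : choiceType) (d : V) (D : {fset K}) (W : {fset V}) :
  finite_set [set f : {fsfun K -> V with d} |
    (finsupp f `<=` D)%fset /\ forall x, x \in D -> f x \in W].
Proof.
set A := [set f | _].
pose g (f : {fsfun K -> V with d}) : {fset K * V} :=
  [fset (x, f x) | x in D]%fset.
have ginj : {in A &, injective g}.
  move=> f f'; rewrite !inE => -[fD _] [f'D _] eg; apply/fsfunP => x.
  have [xD|xND] := boolP (x \in D).
    have: (x, f x) \in g f by apply/imfsetP; exists x.
    by rewrite eg => /imfsetP[y /= _ [-> ->]].
  by rewrite !fsfun_dflt//; apply: contra xND; apply: fsubsetP.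
rewrite -(eq_finite_set (inj_card_eq ginj)).
apply: (@finite_subfset _ (fpowerset (D `*` W)%fset)) => _ [f [fD fW] <-] /=.
rewrite fpowersetE; apply/fsubsetP => _ /imfsetP[x /= xD ->].
by rewrite in_fsetM /= xD fW.
Qed.

Lemma fsum_seq (R : nmodType) (T : choiceType) (A : set T) (s : seq T)
    (F : T -> R) : uniq s -> (forall x, A x -> F x != 0 -> x \in s) ->
  \sum_(x \in A) F x = \sum_(x <- s | x \in A) F x.
Proof.
move=> us sF; rewrite (@bigfs _ _ _ _ _ (fun x => x \in A))//.
  have AE : [set` (fun x => x \in A) : {pred T}] = A.
    by apply/seteqP; split => x /=; [exact: set_mem|exact: mem_set].
  by rewrite AE.
by move=> x /set_mem Ax; apply: contraNeq; apply: sF.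
Qed.

(** The fibres are cut out by a relation, so that an index that merely exists for each element of
    [A], such as the shape of a restricted tableau, can be used. *)
Lemma fsum_fiber (R : nmodType) (I J : choiceType) (A : set I) (s : seq J)
    (r : I -> J -> bool) (F : I -> R) :
  finite_set A -> uniq s ->
  (forall i, A i -> exists2 j, j \in s & forall j', j' \in s -> r i j' = (j' == j)) ->
  \sum_(i \in A) F i = \sum_(j <- s) \sum_(i \in A `&` [set i | r i j]) F i.
Proof.
move=> fA us Ar; rewrite fsbig_finite//.
transitivity (\sum_(i <- fset_set A) \sum_(j <- s | r i j) F i).
  rewrite big_seq [RHS]big_seq; apply: eq_bigr => i.
  rewrite in_fset_set// => /set_mem /Ar[j js rj].
  rewrite big_seq_cond (eq_bigl (fun j' => j' == j)); last first.
    move=> j'; have [/rj->//|/=] := boolP (j' \in s).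
    by case: eqP => // ->; rewrite js.
  by rewrite -big_filter filter_pred1_uniq// big_seq1.
rewrite (exchange_big_dep xpredT)//=; apply: eq_bigr => j _.
rewrite (@fsum_seq _ _ _ (fset_set A)) ?fset_uniq//; last first.
  by move=> i [Ai _] _; rewrite in_fset_set// inE.
rewrite big_seq_cond [RHS]big_seq_cond; apply: eq_bigl => i.
have [iA|//] := boolP (i \in fset_set A).
move: iA; rewrite in_fset_set// => /set_mem Ai /=.
by apply/idP/idP => [rij|]; rewrite inE //= => -[].
Qed.

Lemma fsum_prod (R : idomainType) (I J : choiceType) (A : set I) (B : set J)
    (F : I -> R) (G : J -> R) : finite_set A -> finite_set B ->
  (\sum_(i \in A) F i) * (\sum_(j \in B) G j) =
  \sum_(p \in A `*` B) F p.1 * G p.2.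
Proof.
move=> fA fB; rewrite mulr_fsuml.
under eq_fsbigr do rewrite mulr_fsumr.
by rewrite pair_fsbig.
Qed.

(* Evaluating [beta] at [x] turns the sum into a cardinality. *)
Lemma fsum_neq0 (T : choiceType) (A : set T) (F : T -> Zbeta) (x : int) :
  finite_set A -> A !=set0 -> (forall t, A t -> (F t).[x] = 1) ->
  \sum_(t \in A) F t != 0.
Proof.
move=> fA [t At] F1; apply/eqP => /(congr1 (horner_eval x)).
rewrite fsbig_finite// raddf_sum raddf0 /= big_seq.
rewrite (eq_bigr (fun=> 1)); last first.
  by move=> u; rewrite in_fset_set// => /set_mem /F1.
rewrite -big_seq big_const_seq count_predT iter_addr_0 => /eqP.
rewrite Num.Theory.pnatr_eq0 size_eq0 => /eqP sA.
have: t \in (fset_set A : seq T) by rewrite in_fset_set// inE.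
by rewrite sA.
Qed.

(** Induction on the rank [r]: in the equation for [y] every other surviving term has smaller rank.
    The predicate [P] allows for equations and unknowns that are both limited to a part of [s]; the
    triangularity condition keeps the unknowns outside [P] out of these equations. *)
Lemma triangular_free (R : idomainType) (T : eqType) (s : seq T)
    (A : T -> T -> R) (r : T -> nat) (F : T -> R) (P : pred T) :
  uniq s ->
  (forall x y, x \in s -> y \in s -> P y -> A x y != 0 -> x != y ->
     P x && (r x < r y)%N) ->
  (forall x, A x x != 0) ->
  (forall y, y \in s -> P y -> \sum_(x <- s) F x * A x y = 0) ->
  forall y, y \in s -> P y -> F y = 0.
Proof.
move=> us tri diag sum0 y; have [n] := ubnP (r y).
elim: n => // n IHn in y * => ry ys Py.
have := sum0 y ys Py; rewrite (bigD1_seq y)//= big_seq_cond big1 => [|x].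
  by rewrite addr0 => /eqP; rewrite mulf_eq0 (negPf (diag y)) orbF => /eqP.
move=> /andP[xs xy]; have [->|Axy] := eqVneq (A x y) 0; first by rewrite mulr0.
have /andP[Px rx] := tri x y xs ys Py Axy xy.
by rewrite IHn ?mul0r//; apply: leq_trans rx _.
Qed.

Lemma fsum_ex (R : nmodType) (T : choiceType) (A : set T) (F : T -> R) :
  \sum_(x \in A) F x != 0 -> exists x, A x.
Proof.
move=> nz; apply/not_existsP => A0; move/eqP: nz; apply.
by apply: fsbig1 => x /A0.
Qed.

Lemma big_unique (R : nmodType) (T : eqType) (s : seq T) (P : pred T) x
    (F : T -> R) : uniq s -> x \in s -> P x ->
  (forall y, y \in s -> P y -> y = x) -> \sum_(y <- s | P y) F y = F x.
Proof.
move=> us xs Px Px1; rewrite -big_filter (bigD1_seq x) ?filter_uniq ?mem_filter ?Px//=.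
rewrite big_seq_cond big1 ?addr0// => y; rewrite mem_filter => /andP[/andP[Py ys]].
by rewrite (Px1 y)// eqxx.
Qed.

Lemma count_sum (T : Type) (a : pred T) (s : seq T) :
  count a s = (\sum_(b <- s) a b)%N.
Proof. by rewrite -sum1_count big_mkcond; apply: eq_bigr => b _; case: (a b). Qed.

Lemma count_fset1 (T : choiceType) (p : pred T) x : count p [fset x]%fset = p x.
Proof. by rewrite count_sum big_seq_fset1. Qed.

Lemma leq_mem_sum (T : eqType) (s : seq T) (P : pred T) (F : T -> nat) x :
  x \in s -> P x -> (F x <= \sum_(y <- s | P y) F y)%N.
Proof. by move=> xs Px; rewrite (big_rem x)//= Px leq_addr. Qed.

(** * Monomials and products of series *)

Lemma in_fset_iota n i : (i \in [fset j | j in iota 0 n]%fset) = (i < n)%N.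
Proof. by rewrite !inE mem_iota. Qed.

Definition madd (m n : monom) : monom :=
  [fsfun i in (finsupp m `|` finsupp n)%fset => (m i + n i)%N].

Lemma maddE m n i : madd m n i = (m i + n i)%N.
Proof.
rewrite fsfunE inE; case: ifPn => //; rewrite negb_or => /andP[mi ni].
by rewrite !fsfun_dflt.
Qed.

Lemma maddC m n : madd m n = madd n m.
Proof. by apply/fsfunP => i; rewrite !maddE addnC. Qed.

Definition msub (m n : monom) : monom :=
  [fsfun i in finsupp m => (m i - n i)%N].

Lemma msubE m n i : msub m n i = (m i - n i)%N.
Proof. by rewrite fsfunE; case: ifPn => // mi; rewrite fsfun_dflt. Qed.

Definition mzero : monom := [fsfun].

Lemma mzeroE i : mzero i = 0%N.
Proof. by rewrite fsfun0E. Qed.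

Definition mseq (w : seq nat) : monom :=
  [fsfun i in [fset j | j in iota 0 (size w)]%fset => nth 0%N w i].

Lemma mseqE w i : mseq w i = nth 0%N w i.
Proof.
rewrite fsfunE in_fset_iota; case: ltnP => // wi.
by rewrite nth_default.
Qed.

Definition msingle (N k : nat) : monom := [fsfun i in [fset N]%fset => k].

Lemma msingleE N k i : msingle N k i = if i == N then k else 0%N.
Proof. by rewrite fsfunE inE. Qed.

Lemma mseq_nil : mseq [::] = mzero.
Proof. by apply/fsfunP => i; rewrite mseqE mzeroE nth_nil. Qed.

Lemma mseq_rcons w k : mseq (rcons w k) = madd (mseq w) (msingle (size w) k).
Proof.
apply/fsfunP => i; rewrite maddE msingleE !mseqE nth_rcons.
case: ltngtP => [h|h|->]; rewrite ?addn0//.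
  by rewrite nth_default// ltnW.
by rewrite nth_default.
Qed.

(** The degree in the variables of index at least [k]. Comparing it with [sumn (drop k la)] for all
    [k] is a dominance order read from the tail, for which Schur functions, [GP] and [GQ] are
    triangular. *)
Definition mtail (k : nat) (m : monom) : nat :=
  (\sum_(i <- finsupp m | k <= i) m i)%N.
Definition mdeg (m : monom) : nat := mtail 0 m.

Lemma mtailE k (m : monom) B : (forall i, (B <= i)%N -> m i = 0%N) ->
  mtail k m = (\sum_(k <= i < B) m i)%N.
Proof.
move=> mB; rewrite /mtail big_mkcond -(big_rmcond_in (fun i => i < B)%N) /=; last first.
  by move=> i _; rewrite -leqNgt => /mB->; case: ifP.
rewrite -big_mkcondr /=.
rewrite -big_filter -[RHS]big_filter.
rewrite [RHS](bigID (fun i => m i == 0)%N) /= [X in (X + _)%N]big1 ?add0n; last by move=> i /eqP.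
rewrite -[RHS]big_filter; apply: perm_big; apply: uniq_perm.
- by rewrite filter_uniq// fset_uniq.
- by rewrite !filter_uniq// iota_uniq.
move=> i; rewrite !mem_filter mem_finsupp mem_index_iota.
by case: (m i == 0%N); case: (k <= i)%N; case: (i < B)%N.
Qed.

Lemma sum_nth_drop w k :
  (\sum_(k <= i < size w) nth 0 w i)%N = sumn (drop k w).
Proof.
rewrite sumnE [RHS](big_nth 0%N) size_drop -{1}[k]add0n big_addn.
by apply: eq_bigr => i _; rewrite nth_drop addnC.
Qed.

Lemma mtail_seq k w : mtail k (mseq w) = sumn (drop k w).
Proof.
rewrite (@mtailE _ _ (size w)); last by move=> i wi; rewrite mseqE nth_default.
by rewrite -sum_nth_drop; apply: eq_bigr => i _; rewrite mseqE.
Qed.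

Lemma mdeg_seq w : mdeg (mseq w) = sumn w.
Proof. by rewrite /mdeg mtail_seq drop0. Qed.

Lemma monom_bound (m : monom) : exists B, forall i, (B <= i)%N -> m i = 0%N.
Proof.
exists (\max_(i <- finsupp m) i).+1 => i Bi.
rewrite fsfun_dflt//; apply/negP => im.
suff: (i <= \max_(i <- finsupp m) i)%N by rewrite leqNgt Bi.
by apply: (@leq_bigmax_seq _ _ xpredT id).
Qed.

Lemma mdeg_add m n : mdeg (madd m n) = (mdeg m + mdeg n)%N.
Proof.
have [B mB] := monom_bound m; have [B' nB'] := monom_bound n.
rewrite /mdeg !(@mtailE _ _ (maxn B B')) -?big_split /=.
- by apply: eq_bigr => i _; rewrite maddE.
- by move=> i ?; rewrite nB'//; lia.
- by move=> i ?; rewrite mB//; lia.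
- by move=> i ?; rewrite maddE mB ?nB'//; lia.
Qed.

Lemma mdeg_single N k : mdeg (msingle N k) = k.
Proof.
rewrite /mdeg (@mtailE _ _ N.+1) => [|i]; last first.
  by rewrite msingleE; case: eqP => // ->; rewrite ltnn.
rewrite big_nat_recr//= big_nat_cond big1 ?msingleE ?eqxx// => i.
by rewrite msingleE andbT; case: eqP => // ->; rewrite ltnn.
Qed.

Definition mdivs (m : monom) : seq monom :=
  fset_set [set d : monom | forall i, (d i <= m i)%N].

Lemma finite_mdivs (m : monom) : finite_set [set d : monom | forall i, (d i <= m i)%N].
Proof.
apply: sub_finite_set (@finite_fsfun nat nat 0%N (finsupp m)
  [fset i | i in iota 0 (\max_(i <- finsupp m) m i).+1]%fset) => d dm; split.
  apply/fsubsetP => i; rewrite !mem_finsupp.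
  by apply: contra => /eqP mi; have := dm i; rewrite mi leqn0.
move=> i im; rewrite in_fset_iota ltnS.
apply: leq_trans (dm i) _.
by apply: (@leq_bigmax_seq _ _ xpredT m).
Qed.

Lemma mdivsP (m d : monom) :
  reflect (forall i, (d i <= m i)%N) (d \in mdivs m).
Proof.
rewrite /mdivs in_fset_set; last exact: finite_mdivs.
by apply: (iffP idP); rewrite inE.
Qed.

Lemma mdivs_uniq m : uniq (mdivs m).
Proof. exact: fset_uniq. Qed.

Lemma smulE f g m :
  smul f g m = \sum_(d <- mdivs m) f d * g (msub m d).
Proof.
rewrite fsbig_seq ?mdivs_uniq// /smul.
rewrite [LHS](@reindex_fsbig _ _ _ _ _ (fun d => (d, msub m d)) [set` mdivs m])//.
split.
- move=> d /= /mdivsP dm i; rewrite msubE subnKC//.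
- by move=> d d' _ _ [].
- move=> [d e] /= de; exists d; first by apply/mdivsP => i; rewrite de leq_addr.
  by congr (_, _); apply/fsfunP => i; rewrite msubE de addKn.
Qed.

Lemma smulC f g : smul f g = smul g f.
Proof.
apply/funext => m; rewrite /smul.
rewrite [LHS](@reindex_fsbig _ _ _ _ _ (fun p => (p.2, p.1))
  [set p : monom * monom | forall i, m i = (p.1 i + p.2 i)%N]); last first.
  split=> [p /= h i|[p1 p2] [q1 q2] _ _ /= [-> ->]//|[p q] /= h].
    by rewrite h addnC.
  by exists (q, p) => //= i; rewrite h addnC.
by apply: eq_fsbigr => p _; rewrite mulrC.
Qed.

(** Both sides are sums over ordered pairs of divisors whose product divides [m], and this index set
    is symmetric. *)
Lemma smulCA f g h : smul f (smul g h) = smul g (smul f h).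
Proof.
have smul2E u v w m : smul u (smul v w) m = \sum_(d <- mdivs m)
    \sum_(e <- mdivs m | madd d e \in mdivs m)
      u d * (v e * w (msub m (madd d e))).
  rewrite smulE big_seq [RHS]big_seq; apply: eq_bigr => d /mdivsP dm.
  rewrite smulE mulr_sumr -[RHS]big_filter.
  rewrite (perm_big [seq e <- mdivs m | madd d e \in mdivs m]); last first.
    apply: uniq_perm; rewrite ?filter_uniq ?mdivs_uniq// => e.
    rewrite mem_filter; apply/mdivsP/andP => [em|[/mdivsP dem _] i].
      by split; apply/mdivsP => i; have := em i; have := dm i;
         rewrite ?maddE msubE; lia.
    by have := dem i; rewrite maddE msubE; lia.
  apply: eq_bigr => e _; congr (_ * (_ * w _)).
  by apply/fsfunP => i; rewrite !msubE maddE; lia.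
apply/funext => m; rewrite !smul2E (exchange_big_dep xpredT)//=; apply: eq_bigr => e _.
under eq_bigl => d do rewrite maddC.
by apply: eq_bigr => d _; rewrite mulrCA maddC.
Qed.

Lemma smulA f g h : smul f (smul g h) = smul (smul f g) h.
Proof. by rewrite (smulC g) smulCA smulC. Qed.

Definition sone : series := fun m => (m == mzero)%:R.

Lemma smul1 f : smul sone f = f.
Proof.
apply/funext => m; rewrite smulE (bigD1_seq mzero) ?mdivs_uniq//=; last first.
  by apply/mdivsP => i; rewrite mzeroE.
rewrite big1 => [|d /negPf d0]; last by rewrite /sone d0 mul0r.
rewrite /sone eqxx mul1r addr0; congr f.
by apply/fsfunP => i; rewrite msubE mzeroE subn0.
Qed.

Lemma smul_sumr (I : Type) (s : seq I) (P : pred I) f (c : I -> Zbeta)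
    (g : I -> series) m :
  smul f (fun m => \sum_(i <- s | P i) c i * g i m) m =
  \sum_(i <- s | P i) c i * smul f (g i) m.
Proof.
rewrite smulE; under eq_bigr do rewrite mulr_sumr.
rewrite exchange_big /=; apply: eq_bigr => i _; rewrite smulE mulr_sumr.
by apply: eq_bigr => d _; rewrite mulrCA.
Qed.

Lemma mdeg_div (m d : monom) : d \in mdivs m ->
  (mdeg d + mdeg (msub m d) = mdeg m)%N.
Proof.
move=> /mdivsP dm; rewrite -mdeg_add; congr mdeg.
by apply/fsfunP => i; rewrite maddE msubE subnKC.
Qed.

Lemma smul_lin (I : Type) (s : seq I) f (c : monom -> I -> Zbeta)
    (F : I -> Zbeta) m :
  smul f (fun m => \sum_(i <- s) c m i * F i) m = \sum_(i <- s) smul f (c^~ i) m * F i.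
Proof.
rewrite (_ : (fun m => _) = fun m => \sum_(i <- s) F i * c m i); last first.
  by apply/funext => m'; apply: eq_bigr => i _; rewrite mulrC.
by rewrite smul_sumr; apply: eq_bigr => i _; rewrite mulrC.
Qed.

Lemma mseq_out w i : (size w <= i)%N -> mseq w i = 0%N.
Proof. by move=> wi; rewrite mseqE nth_default. Qed.

Lemma monom_le_deg (m : monom) i : (m i <= mdeg m)%N.
Proof.
have [im|im] := boolP (i \in finsupp m); last by rewrite fsfun_dflt.
exact: leq_mem_sum.
Qed.

(** * Integer partitions *)

Lemma sumn_nth (s : seq nat) B : (size s <= B)%N ->
  sumn s = (\sum_(0 <= i < B) nth 0 s i)%N.
Proof.
move=> sB; rewrite -[s in LHS]drop0 -sum_nth_drop (big_cat_nat (leq0n _) sB) /=.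
rewrite [X in (_ + X)%N]big_nat_cond [X in (_ + X)%N]big1 ?addn0// => i.
by rewrite andbT => /andP[si _]; rewrite nth_default.
Qed.

Lemma nth_sumn_drop (s : seq nat) k :
  (nth 0 s k + sumn (drop k.+1 s) = sumn (drop k s))%N.
Proof.
have [ks|sk] := ltnP k (size s); first by rewrite (drop_nth 0%N ks).
by rewrite nth_default// !drop_oversize// ltnW.
Qed.

(** This is the sum of [(i + 1) * s_i] over zero-based positions [i]. It is strictly monotone for
    the tail dominance order and serves as the rank in [triangular_free]. *)
Definition tail_rank (s : seq nat) : nat :=
  (\sum_(0 <= k < size s) sumn (drop k s))%N.

Lemma tail_rankE (s : seq nat) B : (size s <= B)%N ->
  tail_rank s = (\sum_(0 <= k < B) sumn (drop k s))%N.
Proof.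
move=> sB; rewrite /tail_rank [RHS](big_cat_nat (leq0n _) sB) /=.
rewrite [X in (_ + X)%N]big_nat_cond [X in (_ + X)%N]big1 ?addn0// => i.
by rewrite andbT => /andP[si _]; rewrite drop_oversize.
Qed.

Lemma tail_rank_lt (s t : seq nat) :
  (forall k, (sumn (drop k s) <= sumn (drop k t))%N) ->
  (exists i, nth 0 s i <> nth 0 t i)%N -> (tail_rank s < tail_rank t)%N.
Proof.
move=> st [i]; pose B := maxn (size s) (size t).
rewrite !(@tail_rankE _ B) ?leq_maxl ?leq_maxr//.
apply: contra_notT; rewrite -leqNgt => ts.
have dE k : sumn (drop k s) = sumn (drop k t).
  have [Bk|kB] := leqP B k; first by rewrite !drop_oversize//; lia.
  have : (\sum_(0 <= k < B) sumn (drop k s) ==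
      \sum_(0 <= k < B) sumn (drop k t))%N.
    by rewrite eqn_leq ts leq_sum.
  rewrite (bigD1_seq k) ?iota_uniq ?mem_index_iota//=.
  rewrite [X in _ == X](bigD1_seq k) ?iota_uniq ?mem_index_iota//=.
  have := st k; have := @leq_sum _ (index_iota 0 B) (fun i => i != k) _ _ (fun k _ => st k).
  by move=> /=; lia.
by have := nth_sumn_drop s i; have := nth_sumn_drop t i; rewrite !dE; lia.
Qed.

Lemma eq_from_nth_pos (s t : seq nat) : 0%N \notin s -> 0%N \notin t ->
  (forall i, nth 0 s i = nth 0 t i)%N -> s = t.
Proof.
move=> s0 t0 st; suff sz : size s = size t by apply: (eq_from_nth sz) => i _.
apply/eqP; rewrite eqn_leq; apply/andP; split; rewrite leqNgt; apply/negP => h.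
  by have := mem_nth 0%N h; rewrite st nth_default// (negPf s0).
by have := mem_nth 0%N h; rewrite -st nth_default// (negPf t0).
Qed.

Section IntPartitions.
Implicit Types rho sigma tau : int_partition.

Lemma ip_pos rho : 0%N \notin (rho : seq nat).
Proof. by case: rho => s /= /andP[]. Qed.

Lemma ip_ext rho sigma : (forall i, nth 0 rho i = nth 0 sigma i)%N -> rho = sigma.
Proof. by move=> h; apply/val_inj/eq_from_nth_pos => //=; apply: ip_pos. Qed.

Lemma ip_mono rho i j : (i <= j)%N -> (nth 0 rho j <= nth 0 rho i)%N.
Proof.
move=> ij; have [jr|rj] := ltnP j (size rho); last by rewrite (nth_default _ rj).
case: rho jr => s /= /andP[ss _] js.
by apply: (sorted_leq_nth _ _ 0%N ss) => //; rewrite ?inE ?(leq_ltn_trans ij)//;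
  [move=> a b c ab bc; apply: leq_trans bc ab|move=> a; apply: leqnn].
Qed.

Lemma ip_of_fun (f : nat -> nat) L : (forall i, f i.+1 <= f i)%N -> f L = 0%N ->
  exists rho : int_partition, forall i, nth 0%N rho i = f i.
Proof.
move=> fS fL; have fmono i j : (i <= j)%N -> (f j <= f i)%N.
  elim: j => [|j IHj]; first by rewrite leqn0 => /eqP->.
  by rewrite leq_eqVlt => /predU1P[->//|/IHj]; apply: leq_trans.
have exL : exists l, f l == 0%N by exists L; rewrite fL.
case: (ex_minnP exL) => l /eqP fl lmin.
have ok : sorted geq (mkseq f l) && (0%N \notin mkseq f l).
  apply/andP; split.
    apply/(sortedP 0%N) => i; rewrite size_mkseq => il.
    by rewrite !nth_mkseq ?(ltnW il)//=.
  apply/negP => /mapP[i]; rewrite mem_iota /= => il fi.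
  by have := lmin i; rewrite -fi eqxx => /(_ isT); rewrite leqNgt il.
exists (IntPartition ok) => i /=; have [il|li] := ltnP i l; first by rewrite nth_mkseq.
by rewrite nth_default ?size_mkseq//; have := fmono _ _ li; rewrite fl leqn0 => /eqP.
Qed.

Definition IP (d : nat) : seq int_partition :=
  fset_set [set rho : int_partition | sumn rho = d].

Lemma size_le_sumn (s : seq nat) : 0%N \notin s -> (size s <= sumn s)%N.
Proof. by elim: s => //= x s IHs; rewrite inE negb_or => /andP[? /IHs]; lia. Qed.

Lemma nth_le_sumn (s : seq nat) i : (nth 0 s i <= sumn s)%N.
Proof. by elim: s i => [|x s IHs] [|i] //=; rewrite ?leq_addr// (leq_trans (IHs i))// leq_addl. Qed.

Lemma finite_pos_seq (T : choiceType) (f : T -> seq nat) (d : nat) :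
  injective f -> (forall t, 0%N \notin f t) ->
  finite_set [set t | (sumn (f t) <= d)%N].
Proof.
move=> finj fpos; set A := [set t | _].
have ginj : {in A &, injective (mseq \o f)}.
  move=> t t' _ _ /= /fsfunP h; apply: finj; apply: eq_from_nth_pos => // i.
  by have := h i; rewrite !mseqE.
rewrite -(eq_finite_set (inj_card_eq ginj)).
have := @finite_fsfun nat nat 0%N [fset i | i in iota 0 d]%fset
  [fset i | i in iota 0 d.+1]%fset.
apply: sub_finite_set => _ [t td <-]; split.
  apply/fsubsetP => i; rewrite mem_finsupp mseqE in_fset_iota.
  apply: contraR; rewrite -leqNgt => di; rewrite nth_default//.
  exact: leq_trans (size_le_sumn (fpos t)) (leq_trans td di).
by move=> i _; rewrite in_fset_iota ltnS mseqE (leq_trans (nth_le_sumn _ _) td).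
Qed.

Lemma mem_IP d rho : (rho \in IP d) = (sumn rho == d).
Proof.
rewrite /IP in_fset_set; first by apply/idP/eqP; rewrite inE.
have := @finite_pos_seq int_partition parts d val_inj ip_pos.
by apply: sub_finite_set => r /= ->.
Qed.

Lemma IP_uniq d : uniq (IP d).
Proof. exact: fset_uniq. Qed.

Lemma count_sorted (s : seq nat) i j : sorted geq s ->
  (i < count (leq j.+1) s)%N = (j < nth 0 s i)%N.
Proof.
elim: s i => [|x s IHs] i; first by rewrite nth_nil.
move=> /= pxs; have ss := path_sorted pxs.
have [jx|xj] := ltnP j x; last first.
  have s0 : count (leq j.+1) s = 0%N.
    apply/eqP; rewrite -leqn0 leqNgt -has_count; apply/hasPn => y ys.
    have := order_path_min _ pxs.
    have tr : transitive geq by move=> a b c ab bc; apply: leq_trans bc ab.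
    by move=> /(_ tr) /allP /(_ y ys) /= yx; rewrite -leqNgt (leq_trans yx).
  rewrite s0 addn0 ltn0; apply/esym/negbTE; rewrite -leqNgt.
  case: i => [|i] //=; have := IHs i ss; rewrite s0 ltn0 => /esym/negbT.
  by rewrite -leqNgt.
by rewrite add1n; case: i => [|i] /=; rewrite ?jx// ltnS IHs.
Qed.

(** Transposition as an exchange of rows and columns; later facts about transposes go through this
    equivalence instead of the list [conj_seq]. *)
Lemma conjP rho i j : (i < nth 0 (conj_partition rho) j)%N = (j < nth 0 rho i)%N.
Proof.
have /andP[ss _] := valP rho; rewrite /= /conj_seq.
have [jh|hj] := ltnP j (head 0%N rho); first by rewrite nth_mkseq// count_sorted.
rewrite nth_default ?size_mkseq// ltn0; apply/esym/negbTE; rewrite -leqNgt.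
by apply: leq_trans hj; rewrite -nth0 ip_mono.
Qed.

Lemma leq_of_ltn (a b : nat) : (forall i, i < a -> i < b)%N -> (a <= b)%N.
Proof. by move=> h; rewrite leqNgt; apply/negP => /h; rewrite ltnn. Qed.

Lemma conjK : involutive conj_partition.
Proof.
move=> rho; apply: ip_ext => i; apply/eqP.
by rewrite eqn_leq; apply/andP; split; apply: leq_of_ltn => j;
   rewrite conjP (conjP rho).
Qed.

Lemma nth_sum_lt (s : seq nat) B i : (sumn s <= B)%N ->
  nth 0%N s i = (\sum_(0 <= j < B) (j < nth 0 s i)%N)%N.
Proof.
move=> sB; have nB := leq_trans (nth_le_sumn s i) sB.
rewrite (big_cat_nat (leq0n _) nB) /=.
rewrite big_nat_cond (eq_bigr (fun=> 1%N)) => [|j]; last first.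
  by rewrite andbT => /andP[_ ->].
rewrite -big_nat_cond [X in (_ + X)%N]big_nat_cond [X in (_ + X)%N]big1 => [|j].
  by rewrite sum_nat_const_nat muln1 subn0 addn0.
by rewrite andbT => /andP[nj _]; rewrite ltnNge nj.
Qed.

(** Both sides count the boxes inside a [B] by [B] square, once by rows and once by columns. *)
Lemma sumn_conj rho : sumn (conj_partition rho) = sumn rho.
Proof.
have [B []] : exists B, (sumn rho <= B)%N /\ (sumn (conj_partition rho) <= B)%N.
  by exists (maxn (sumn rho) (sumn (conj_partition rho))); rewrite leq_maxl leq_maxr.
move: (conj_partition rho) (@conjP rho) => rho' rhoE rB rB'.
rewrite (@sumn_nth rho' B) ?(leq_trans (size_le_sumn (ip_pos _)))//.
rewrite (@sumn_nth rho B) ?(leq_trans (size_le_sumn (ip_pos _)))//.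
rewrite (eq_bigr _ (fun i _ => nth_sum_lt i rB')).
rewrite [RHS](eq_bigr _ (fun i _ => nth_sum_lt i rB)).
rewrite exchange_big /=; apply: eq_bigr => i _; apply: eq_bigr => j _.
by rewrite rhoE.
Qed.

(** [rho] is the outer shape. Interlacing says that [rho/sigma] has at most one box per column;
    [vstrip] below asks for at most one box per row. *)
Definition hstrip rho sigma : bool :=
  `[< forall i, (nth 0 rho i.+1 <= nth 0 sigma i <= nth 0 rho i)%N >].

Definition vstrip rho sigma : bool :=
  `[< forall i, (nth 0 sigma i <= nth 0 rho i <= (nth 0 sigma i).+1)%N >].

Lemma hstrip_conj rho sigma :
  hstrip (conj_partition rho) (conj_partition sigma) = vstrip rho sigma.
Proof.
apply/asboolP/asboolP => h i.
  apply/andP; split; apply: leq_of_ltn => j.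
    rewrite -(conjP sigma) -(conjP rho) => ij; have /andP[_ hj] := h j; exact: leq_trans hj.
  case: j => // j; rewrite ltnS -(conjP sigma) -(conjP rho) => ij.
  by have /andP[hj _] := h j; apply: leq_trans hj.
apply/andP; split; apply: leq_of_ltn => j; rewrite (conjP rho) (conjP sigma) => ij.
  by have /andP[_ hj] := h j; have := leq_trans ij hj; rewrite ltnS.
by have /andP[hj _] := h j; apply: leq_trans hj.
Qed.

End IntPartitions.

(** * Horizontal and vertical strips *)

Section Strips.
Implicit Types rho sigma tau : int_partition.

Lemma sumn_le_nth (s t : seq nat) : (forall i, nth 0 s i <= nth 0 t i)%N ->
  (sumn s <= sumn t)%N.
Proof.
move=> st; rewrite !(@sumn_nth _ (maxn (size s) (size t))) ?leq_maxl ?leq_maxr//.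
exact: leq_sum.
Qed.

Lemma ip_eq_sumn rho tau : (forall i, nth 0 tau i <= nth 0 rho i)%N ->
  (sumn rho <= sumn tau)%N -> rho = tau.
Proof.
move=> tr srt; apply: ip_ext => i.
pose B := (maxn i.+1 (maxn (size rho) (size tau))).
move: srt; rewrite !(@sumn_nth _ B) ?/B; try lia.
rewrite (bigD1_seq i) ?iota_uniq ?mem_index_iota//=; last by lia.
rewrite [X in (_ <= X)%N](bigD1_seq i) ?iota_uniq ?mem_index_iota//=; last by lia.
have := tr i; have := @leq_sum _ (index_iota 0 B) (fun k => k != i) _ _ (fun k _ => tr k).
by move=> /=; rewrite /B; lia.
Qed.

(** On the coefficients of a Schur expansion, [hop k] and [eop k] are the adjoints of multiplication
    by the complete and the elementary symmetric function of degree [k]. *)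
Definition hop k (c : int_partition -> Zbeta) tau : Zbeta :=
  \sum_(rho <- IP (sumn tau + k) | hstrip rho tau) c rho.
Definition eop k (c : int_partition -> Zbeta) tau : Zbeta :=
  \sum_(rho <- IP (sumn tau + k) | vstrip rho tau) c rho.

Lemma eop_ext k c c' tau : c =1 c' -> eop k c tau = eop k c' tau.
Proof. by move=> cc'; apply: eq_bigr => rho _. Qed.

Lemma hstrip_refl tau : hstrip tau tau.
Proof. by apply/asboolP => i; rewrite leqnn andbT ip_mono. Qed.
Lemma vstrip_refl tau : vstrip tau tau.
Proof. by apply/asboolP => i; rewrite leqnn leqnSn. Qed.

Lemma hop0 c tau : hop 0 c tau = c tau.
Proof.
rewrite /hop addn0 (@big_unique _ _ _ _ tau) ?IP_uniq ?mem_IP ?hstrip_refl//=.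
move=> rho; rewrite mem_IP => /eqP sr.
move=> /asboolP h; apply: ip_eq_sumn; last by rewrite sr.
by move=> i; have /andP[] := h i.
Qed.

Lemma eop0 c tau : eop 0 c tau = c tau.
Proof.
rewrite /eop addn0 (@big_unique _ _ _ _ tau) ?IP_uniq ?mem_IP ?vstrip_refl//=.
move=> rho; rewrite mem_IP => /eqP sr.
move=> /asboolP h; apply: ip_eq_sumn; last by rewrite sr.
by move=> i; have /andP[] := h i.
Qed.

(** The shapes [sigma] through which a coefficient [c rho] reaches [tau] in the composite
    [eop i (hop (k - i) c)]. *)
Definition between rho tau sigma := vstrip sigma tau && hstrip rho sigma.

(* The parts of [sigma] vary independently of each other; where [i0] is the last
   row in which [rho] exceeds [tau], both [tau_i0] and [tau_i0 + 1] are allowed. *)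
Lemma toggle_part rho tau : (sumn tau < sumn rho)%N ->
  exists t : int_partition -> int_partition, forall sigma, between rho tau sigma ->
    [/\ between rho tau (t sigma), t (t sigma) = sigma &
        odd (sumn (t sigma)) = ~~ odd (sumn sigma)].
Proof.
move=> tr.
have [i0 [ti0 i0max]] : exists i0, (nth 0 tau i0 < nth 0 rho i0)%N /\
    forall i, (i0 < i)%N -> (nth 0 rho i <= nth 0 tau i)%N.
  have ex : exists i, (nth 0 tau i < nth 0 rho i)%N.
    apply/not_existsP => h; move: tr; rewrite ltnNge sumn_le_nth// => i.
    by rewrite leqNgt; apply/negP/h.
  have bd i : (nth 0 tau i < nth 0 rho i)%N -> (i <= size rho)%N.
    by apply: contraLR; rewrite -ltnNge -leqNgt => ri; rewrite nth_default// ltnW.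
  case: (ex_maxnP ex bd) => i0 ti0 i0max; exists i0; split=> // i i0i.
  by rewrite leqNgt; apply: contraL i0i => /i0max; rewrite -leqNgt.
(* Reflection of [sigma_i0] within the two values [tau_i0] and [tau_i0 + 1]. *)
pose f sigma i :=
  if i == i0 then ((nth 0 tau i0).*2.+1 - nth 0 sigma i0)%N else nth 0%N sigma i.
have exT sigma : exists sigma', between rho tau sigma ->
    forall i, nth 0%N sigma' i = f sigma i.
  case: (boolP (between rho tau sigma)) => [|_]; last by exists sigma.
  move=> /andP[/asboolP vs /asboolP hs].
  have [||sigma' s'E] := @ip_of_fun (f sigma) (maxn i0.+1 (size rho)); last by exists sigma'.
    (* The reflected sequence still decreases: [sigma_(i0 - 1) >= rho_i0 > tau_i0] leaves room
       above, and [sigma_(i0 + 1) <= rho_(i0 + 1) <= tau_(i0 + 1) <= tau_i0] leaves room below. *)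
    move=> i; rewrite /f; have /andP[v1 v2] := vs i0; have /andP[h1 h2] := hs i.
    have /andP[h1' h2'] := hs i.+1; have /andP[w1 w2] := vs i.
    case: (eqVneq i i0) => [ii0|ni]; case: (eqVneq i.+1 i0) => [Sii0|nSi]; try lia.
      have := i0max i.+1; have := ip_mono tau (leqnSn i0).
      move: h1 h2 h1' h2' ti0; rewrite ii0; lia.
    by move: h1 ti0; rewrite -Sii0; move: v1 v2; rewrite -Sii0; lia.
  rewrite /f; case: eqP => [|_]; first by lia.
  by have /andP[_] := hs (maxn i0.+1 (size rho)); rewrite (nth_default _ (leq_maxr _ _)) leqn0 => /eqP.
have [t tP] := boolp.choice exT; exists t => sigma bs.
have tE := tP _ bs; have /andP[/asboolP vs /asboolP hs] := bs.
have /andP[v1 v2] := vs i0.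
have bt : between rho tau (t sigma).
  apply/andP; split; apply/asboolP => i; rewrite tE /f; have /andP[w1 w2] := vs i;
    have /andP[h1 h2] := hs i; case: (eqVneq i i0) => [ii0|ni]; rewrite -?ii0; try lia.
  have := i0max i.+1; have := ip_mono tau (leqnSn i0).
  by move: h1 h2 ti0 v1 v2; rewrite ii0; lia.
split=> //.
  apply: ip_ext => i; rewrite (tP _ bt) /f !tE /f eqxx.
  by case: (eqVneq i i0) => [->|//]; lia.
pose B := maxn i0.+1 (maxn (size sigma) (size (t sigma))).
rewrite !(@sumn_nth _ B) ?/B; try lia.
rewrite (bigD1_seq i0) ?iota_uniq ?mem_index_iota//=; last by lia.
rewrite [X in _ = ~~ odd X](bigD1_seq i0) ?iota_uniq ?mem_index_iota//=; last by lia.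
rewrite (eq_bigr (nth 0%N sigma)); last first.
  by move=> i /negPf ni; rewrite tE /f ni.
rewrite tE /f eqxx !oddD.
by set x := odd (\sum_(_ <- _ | _) _)%N; move: x => x; lia.
Qed.


Definition IPle (d : nat) : seq int_partition :=
  fset_set [set rho : int_partition | (sumn rho <= d)%N].

Lemma mem_IPle d rho : (rho \in IPle d) = (sumn rho <= d)%N.
Proof.
rewrite /IPle in_fset_set; first by apply/idP/idP; rewrite inE.
exact: (@finite_pos_seq int_partition parts d val_inj ip_pos).
Qed.

Lemma IPle_uniq d : uniq (IPle d).
Proof. exact: fset_uniq. Qed.

(** The involution of [toggle_part] reverses the sign, so the sum equals its own negative. *)
Lemma strip_cancel rho tau : (sumn tau < sumn rho)%N ->
  \sum_(sigma <- IPle (sumn rho) | between rho tau sigma)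
     (-1) ^+ sumn sigma = 0 :> int.
Proof.
move=> tr; have [t tP] := toggle_part tr.
set S := \sum_(_ <- _ | _) _; suff SN : S = - S by lia.
pose s := [seq sigma <- IPle (sumn rho) | between rho tau sigma].
have btw_le sigma : between rho tau sigma -> (sumn sigma <= sumn rho)%N.
  move=> /andP[_ /asboolP h]; apply: sumn_le_nth => i; by have /andP[] := h i.
have sE sigma : sigma \in s = between rho tau sigma.
  rewrite mem_filter mem_IPle; apply/andP/idP => [[]//|b]; split => //.
  exact: btw_le.
rewrite /S -big_filter -/s -sumrN [LHS](perm_big [seq t x | x <- s]) /=; last first.
  apply: uniq_perm; rewrite ?filter_uniq ?IPle_uniq//.
    rewrite map_inj_in_uniq ?filter_uniq ?IPle_uniq// => x y.
    rewrite !sE => /tP[_ tx _] /tP[_ ty _] txy.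
    by rewrite -tx txy ty.
  move=> sigma; apply/idP/mapP => [|[x + ->]]; rewrite !sE.
    by move=> /tP[bt tts _]; exists (t sigma); rewrite ?sE.
  by case/tP.
rewrite big_map big_seq [RHS]big_seq; apply: eq_bigr => sigma.
rewrite sE => /tP[_ _ ot].
by rewrite -signr_odd ot -[in RHS]signr_odd; case: odd; rewrite ?expr0 ?expr1 ?opprK.
Qed.

(** Operator form of [H(t) E(-t) = 1] in positive degree: the coefficient of each [c rho] is a
    signed count of intermediate shapes, which cancels because [rho] is larger than [tau]. *)
Lemma strip_inversion c tau k : (0 < k)%N ->
  \sum_(i < k.+1) (-1) ^+ i * eop i (hop (k - i) c) tau = 0.
Proof.
move=> k0; pose s := IP (sumn tau + k).
transitivity (\sum_(rho <- s) c rho *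
    (\sum_(sigma <- IPle (sumn rho) | between rho tau sigma)
       (-1) ^+ (sumn sigma + sumn tau))); last first.
  rewrite big_seq big1// => rho; rewrite mem_IP => /eqP sr.
  rewrite (eq_bigr (fun sigma : int_partition =>
     (-1) ^+ sumn tau * ((-1) ^+ sumn sigma)%:~R)); last first.
    by move=> sigma _; rewrite rmorphXn /= rmorphN1 addnC exprD.
  rewrite -mulr_sumr -raddf_sum /= strip_cancel ?mulr0// sr; lia.
(* The sign [(-1)^i] becomes [(-1)^(|sigma| + |tau|)], since [|sigma| = |tau| + i]. It no longer
   mentions [i], so the sums over [i] and [sigma] can be merged. *)
transitivity (\sum_(i < k.+1) \sum_(rho <- s)
    \sum_(sigma <- IP (sumn tau + i) | between rho tau sigma)
      c rho * (-1) ^+ (sumn sigma + sumn tau)).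
  apply: eq_bigr => i _; rewrite /eop mulr_sumr.
  transitivity (\sum_(sigma <- IP (sumn tau + i) | vstrip sigma tau)
      \sum_(rho <- s | hstrip rho sigma) c rho * (-1) ^+ (sumn sigma + sumn tau)).
    rewrite big_seq_cond [RHS]big_seq_cond; apply: eq_bigr => sigma.
    rewrite mem_IP => /andP[/eqP ss _]; rewrite -mulr_suml mulrC; congr (_ * _).
      by rewrite /hop ss /s; congr (\sum_(_ <- IP _ | _) _); have := ltn_ord i; lia.
    by rewrite ss addnAC addnn exprD -mul2n exprM sqrrN !expr1n mul1r.
  by rewrite (exchange_big_dep xpredT).
rewrite exchange_big /= big_seq [RHS]big_seq; apply: eq_bigr => rho.
rewrite mem_IP => /eqP sr; rewrite mulr_sumr.
transitivity (\sum_(i < k.+1)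
    \sum_(sigma <- IPle (sumn rho) | between rho tau sigma && (sumn sigma == sumn tau + i)%N)
      c rho * (-1) ^+ (sumn sigma + sumn tau)).
  apply: eq_bigr => i _; rewrite -big_filter -[RHS]big_filter; apply: perm_big.
  apply: uniq_perm; rewrite ?filter_uniq ?IPle_uniq ?IP_uniq// => sigma.
  rewrite !mem_filter mem_IP mem_IPle; have := ltn_ord i.
  by case: between => //=; case: eqP => //= ->; lia.
rewrite (exchange_big_dep (between rho tau)) /=; last by move=> i sigma _ /andP[].
rewrite big_seq_cond [RHS]big_seq_cond; apply: eq_bigr => sigma.
rewrite mem_IPle => /andP[sr' bs]; rewrite bs /=.
have /andP[/asboolP vs _] := bs.
have ts : (sumn tau <= sumn sigma)%N.
  by apply: sumn_le_nth => i; have /andP[] := vs i.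
have ok : (sumn sigma - sumn tau < k.+1)%N by lia.
rewrite (@big_unique _ _ _ _ (Ordinal ok)) ?index_enum_uniq ?mem_index_enum//=.
  by rewrite subnKC.
by move=> i _ /eqP si; apply: val_inj => /=; lia.
Qed.

End Strips.

(** * Counting boxes by rows *)

Lemma mtail_count (T : eqType) (m : monom) (v : T -> nat) (s : seq T) k :
  (forall i, m i = count (fun b => v b == i) s) ->
  mtail k m = count (fun b => k <= v b)%N s.
Proof.
move=> mE; have [B mB] := monom_bound m.
have vB b : b \in s -> (v b < B)%N.
  move=> bs; rewrite ltnNge; apply/negP => /mB /eqP.
  by rewrite mE -leqn0 leqNgt -has_count => /negP[]; apply/hasP; exists b.
rewrite (@mtailE _ _ B)// count_sum.
under eq_bigr do rewrite mE count_sum.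
rewrite exchange_big /= big_seq [RHS]big_seq; apply: eq_bigr => b bs.
have -> : (\sum_(k <= i < B) (v b == i) = count (pred1 (v b)) (index_iota k B))%N.
  by rewrite count_sum; apply: eq_bigr => i _; rewrite /= eq_sym.
by rewrite count_uniq_mem ?iota_uniq// mem_index_iota (vB b bs) andbT.
Qed.

(** The offset [o i] is the first column of row [i]: constantly 1 for Young diagrams and [i] for
    shifted ones, so that both kinds are counted together. *)
Lemma count_rows (D : {fset box}) (s : seq nat) (o : nat -> nat) (p : pred nat) :
  (forall i j, ((i, j) \in D) = [&& (0 < i)%N, (o i <= j)%N & (j < o i + part s i)%N]) ->
  count (fun b => p b.1) D = (\sum_(0 <= i < size s | p i.+1) nth 0 s i)%N.
Proof.
move=> inD; rewrite -sum1_count.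
rewrite (perm_big [seq ((i, j) : nat * nat) | i <- iota 1 (size s), j <- iota (o i) (part s i)]) /=; last first.
  apply: uniq_perm; first exact: fset_uniq.
    apply: allpairs_uniq_dep => [|i _|[i j] [i' j'] _ _ /= [-> ->]//];
      exact: iota_uniq.
  move=> [i j]; rewrite inD; apply/and3P/allpairsPdep => [[i0 oj jp]|[i' [j' []]]].
    exists i, j; rewrite !mem_iota oj jp i0; split => //=.
    rewrite add1n ltnS leqNgt; apply/negP => si.
    by move: jp; rewrite /part nth_default ?addn0 ?ltnNge ?oj//; lia.
  by rewrite !mem_iota => /andP[? _] /andP[? ?] [-> ->].
rewrite big_mkcond big_allpairs_dep /= -(addn0 1%N) iotaDl big_map.
rewrite /index_iota subn0 [RHS]big_mkcond; apply: eq_bigr => i _.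
rewrite add1n -big_mkcond /= -[RHS]/(if _ then part s i.+1 else _).
by rewrite big_const_seq iter_addn_0; case: (p i.+1); rewrite ?mul1n ?count_predT ?size_iota ?count_pred0.
Qed.

Section DiagramCounts.
Variables (D : {fset box}) (s : seq nat) (o : nat -> nat).
Hypothesis inD : forall i j,
  ((i, j) \in D) = [&& (0 < i)%N, (o i <= j)%N & (j < o i + part s i)%N].

Lemma count_rows_gt k : count (fun b => k < b.1)%N D = sumn (drop k s).
Proof.
by rewrite (count_rows _ inD) -sum_nth_drop [RHS](big_nat_widenl k 0).
Qed.

Lemma count_rows_le k : count (fun b => b.1 <= k)%N D = sumn (take k s).
Proof.
have tot : count xpredT D = (sumn (take k s) + sumn (drop k s))%N.
  rewrite -sumn_cat cat_take_drop -[s in RHS]drop0 -count_rows_gt.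
  by apply: eq_in_count => -[i j]; rewrite inD => /andP[].
have := count_rows_gt k; rewrite count_predT in tot.
rewrite (eq_count (a2 := predC (fun b : box => b.1 <= k)%N)) => [e|b /=].
  by have := count_predC (fun b : box => b.1 <= k)%N D; rewrite tot e => /addIn.
by rewrite ltnNge.
Qed.

Lemma count_row_eq k : count (fun b => b.1.-1 == k)%N D = nth 0%N s k.
Proof.
rewrite (count_rows (fun i => i.-1 == k) inD) /=.
have [sk|ks] := leqP (size s) k.
  by rewrite nth_default// big_nat_cond big1// => i; lia.
by rewrite (@big_unique _ _ _ _ k) ?iota_uniq ?mem_index_iota// => i _ /eqP.
Qed.

Lemma size_diagram : size D = sumn s.
Proof.
rewrite -[s in RHS]drop0 -count_rows_gt -count_predT.
by apply: eq_in_count => -[i j]; rewrite inD => /andP[].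
Qed.

End DiagramCounts.

Lemma in_YD (la : int_partition) i j :
  ((i, j) \in YD la) = [&& (0 < i)%N, (0 < j)%N & (j < 1 + part la i)%N].
Proof.
apply/imfset2P/and3P => [[i' /=]|[i0 j0 ltj]].
  rewrite mem_iota => /andP[i0 _] [j' /=].
  by rewrite mem_iota => /andP[? ?] [-> ->].
exists i => /=; last by exists j => //=; rewrite mem_iota j0.
rewrite mem_iota i0 /= add1n ltnS leqNgt; apply/negP => lti.
by move: ltj; rewrite /part nth_default; lia.
Qed.

Lemma YDP (la : int_partition) i j :
  ((i.+1, j.+1) \in YD la) = (j < nth 0 la i)%N.
Proof. by rewrite in_YD. Qed.

Lemma YD_inj : injective YD.
Proof.
move=> r s rs; apply: ip_ext => i; apply/eqP; rewrite eqn_leq.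
by apply/andP; split; apply: leq_of_ltn => j; rewrite -YDP ?rs -YDP ?rs.
Qed.

(** * Schur functions *)

Lemma leq_pred_ltn k i t : (k < i)%N -> (i <= t)%N -> (k <= t.-1)%N.
Proof. lia. Qed.

Section Schur.
Implicit Types (rho sigma tau : int_partition) (T : filling) (n : monom).

Definition ssyt_weight T n :=
  forall i, n i = count (fun b => (T b).-1 == i) (finsupp T).

Lemma ssyt_weight_bound T n B b : ssyt_weight T n ->
  (forall i, (B <= i)%N -> n i = 0%N) -> (T b <= B)%N.
Proof.
move=> wT nB; have [bT|bT] := boolP (b \in finsupp T); last by rewrite fsfun_dflt.
move: (bT); rewrite mem_finsupp => Tb; rewrite leqNgt; apply/negP => BT.
have := nB (T b).-1; rewrite wT => /(_ ltac:(lia)) /eqP.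
by rewrite -leqn0 leqNgt -has_count => /negP[]; apply/hasP; exists b.
Qed.

Lemma finite_ssyt rho n : finite_set [set T | ssyt rho T /\ ssyt_weight T n].
Proof.
have [B nB] := monom_bound n.
have := @finite_fsfun box nat 0%N (YD rho) [fset i | i in iota 0 B.+1]%fset.
apply: sub_finite_set => T [[sT _ _] wT]; split; first by rewrite sT.
by move=> b _; rewrite in_fset_iota ltnS; apply: ssyt_weight_bound wT nB.
Qed.

Lemma ssyt_row_le rho T i j : ssyt rho T -> (i, j) \in YD rho -> (i <= T (i, j))%N.
Proof.
move=> [sT _ cT]; elim: i => [|i IHi] // iD.
have [iz|i0] := posnP i; first by move: iD; rewrite iz -sT mem_finsupp lt0n.
have iD' : (i, j) \in YD rho.
  move: iD; rewrite !in_YD i0 /= => /andP[-> /=] h; apply: leq_trans h _.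
  by rewrite leq_add2l /part; apply: ip_mono; lia.
exact: leq_ltn_trans (IHi iD') (cT _ _ _ iD' iD (ltnSn i)).
Qed.

(** Columns increase strictly, so an entry of row [i] is at least [i], and every box below row [k]
    carries a variable of index at least [k]. *)
Lemma schur_tail rho n k : schur rho n != 0 -> (sumn (drop k rho) <= mtail k n)%N.
Proof.
move=> /fsum_ex[T [ST wT]]; rewrite (mtail_count _ wT).
have [sT _ _] := ST; rewrite sT -(count_rows_gt (o := fun=> 1%N) (in_YD rho)).
rewrite !count_sum [leqLHS]big_seq [leqRHS]big_seq; apply: leq_sum => -[i j] bD /=.
have := ssyt_row_le ST bD; case: (ltnP k i) => // ki iT.
by rewrite (leq_pred_ltn ki iT).
Qed.

Lemma schur_deg rho n : schur rho n != 0 -> sumn rho = mdeg n.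
Proof.
move=> /fsum_ex[T [[sT _ _] wT]]; rewrite /mdeg (mtail_count _ wT) sT count_predT.
by rewrite (size_diagram (o := fun=> 1%N) (in_YD rho)).
Qed.

Lemma schur_diag rho : schur rho (mseq rho) != 0.
Proof.
apply: (@fsum_neq0 _ _ _ 0); first exact: finite_ssyt.
  (* The superstandard tableau: row [i] is filled with [i]. *)
  pose T : filling := [fsfun b in YD rho => b.1].
  have TE b : b \in YD rho -> T b = b.1 by move=> bD; rewrite fsfunE bD.
  have sT : finsupp T = YD rho.
    apply/fsetP => -[i j]; rewrite mem_finsupp fsfunE; case: ifPn => //.
    by rewrite in_YD lt0n => /andP[-> _].
  exists T; split; first split => //.
  - by move=> i j j' D D' _; rewrite !TE.
  - by move=> i i' j D D' ii'; rewrite !TE.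
  move=> i; rewrite mseqE sT -(count_row_eq (o := fun=> 1%N) (in_YD rho)).
  by apply: eq_in_count => b bD; rewrite TE.
by move=> T _; rewrite hornerC.
Qed.

Lemma schur_free (c : int_partition -> Zbeta) d :
  (forall w : seq nat, sumn w = d -> \sum_(rho <- IP d) c rho * schur rho (mseq w) = 0) ->
  forall rho, sumn rho = d -> c rho = 0.
Proof.
move=> h rho sr; have rd : rho \in IP d by rewrite mem_IP sr.
apply: (@triangular_free _ _ (IP d) (fun r s => schur r (mseq s))
  (fun s : int_partition => tail_rank s) c xpredT (IP_uniq d) _ schur_diag _ rho rd isT).
  move=> x y _ _ _ xy nxy; apply: tail_rank_lt => [k|].
    by have := schur_tail k xy; rewrite mtail_seq.
  by apply: contrapT => /forallNP e; move/eqP: nxy; apply; apply: ip_ext => i; apply: contrapT => /e.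
by move=> y; rewrite mem_IP => /eqP sy _; apply: h.
Qed.

(** Entries above [N] are reset to the default 0, which removes their boxes from the support. *)
Definition restr N T : filling :=
  [fsfun b in finsupp T => if (T b <= N)%N then T b else 0%N].

Lemma restrE N T b : restr N T b = if (T b <= N)%N then T b else 0%N.
Proof.
by rewrite fsfunE; case: ifPn => // bT; rewrite fsfun_dflt.
Qed.

Lemma mem_finsupp_restr N T b :
  (b \in finsupp (restr N T)) = (b \in finsupp T) && (T b <= N)%N.
Proof.
by rewrite !mem_finsupp restrE; case: leqP; rewrite ?andbT ?andbF.
Qed.

Lemma count_down (p : pred nat) L j :
  (forall i i', (i <= i')%N -> p i' -> p i) ->
  (j < count p (iota 0 L))%N = (j < L)%N && p j.
Proof.
move=> pd; elim: L => [|L IHL]; first by rewrite ltn0.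
rewrite -(addn1 L) iotaD count_cat /= add0n addn0.
have [pL|pL] := boolP (p L); last first.
  rewrite addn0 IHL; case: (ltngtP j L) => jL; rewrite ?addn1 ?ltnS ?(ltnW jL)//=.
    by rewrite leqNgt jL.
  by rewrite jL (negPf pL) andbF.
have -> : count p (iota 0 L) = L.
  rewrite -[RHS](size_iota 0 L); apply/eqP; rewrite -all_count; apply/allP => i.
  by rewrite mem_iota => /andP[_ iL]; apply: pd pL; apply: ltnW.
by apply/esym/andb_idr => jL; apply: pd pL; lia.
Qed.

(** * Branching rule: splitting off the last variable of a Schur function *)

Section Branching.
Variables (rho : int_partition) (n : monom) (N k : nat).
Hypothesis nN : forall i, (N <= i)%N -> n i = 0%N.
Let n' := madd n (msingle N k).

Let n'E i : n' i = if i == N then k else n i.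
Proof. by rewrite maddE msingleE; case: eqP => [->|]; rewrite ?addn0// nN. Qed.

Let n'N i : (N.+1 <= i)%N -> n' i = 0%N.
Proof. by move=> Ni; rewrite n'E nN; [case: eqP Ni => // ->; rewrite ltnn|lia]. Qed.

Lemma restr_shape T : ssyt rho T -> ssyt_weight T n' ->
  exists2 sigma, hstrip rho sigma & finsupp (restr N T) = YD sigma.
Proof.
move=> [sT rT cT] wT; have TN b := ssyt_weight_bound b wT n'N.
have T0 i j : (i, j) \in YD rho -> (0 < T (i, j))%N by rewrite -sT mem_finsupp lt0n.
(* The length of row [i + 1] of the restricted shape. *)
pose f i := count (fun j => (j < nth 0 rho i) && (T (i.+1, j.+1) <= N))%N (iota 0 (nth 0 rho i)).
have fE i j : (j < f i)%N = (j < nth 0 rho i)%N && (T (i.+1, j.+1) <= N)%N.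
  rewrite count_down; first by case: ltnP.
  move=> a b ab /andP[br Tb]; have ar := leq_ltn_trans ab br; rewrite ar /=.
  move: ab; rewrite leq_eqVlt => /predU1P[->//|ab].
  by apply: leq_trans Tb; apply: rT; rewrite ?YDP.
have [||sigma sE] := @ip_of_fun f (size rho).
- move=> i; apply: leq_of_ltn => j; rewrite !fE => /andP[jr Tj].
  have jr' : (j < nth 0 rho i)%N by apply: leq_trans jr (ip_mono _ (leqnSn i)).
  rewrite jr' /=; apply: ltnW; apply: leq_trans Tj.
  by apply: cT; rewrite ?YDP.
- apply/eqP; rewrite -leqn0; apply: leq_of_ltn => j; rewrite fE nth_default//.
exists sigma.
  apply/asboolP => i; rewrite sE; apply/andP; split; apply: leq_of_ltn => j; last first.
    by rewrite fE => /andP[].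
  (* Entries are at most [N + 1], so by strictness in columns the box above any box has an entry at
     most [N]; hence the removed strip is horizontal. *)
  move=> jr; have jr' : (j < nth 0 rho i)%N by apply: leq_trans jr (ip_mono _ (leqnSn i)).
  rewrite fE jr' -ltnS; apply: leq_trans (TN (i.+2, j.+1)).
  by apply: cT; rewrite ?YDP.
apply/fsetP => -[i j]; rewrite mem_finsupp_restr sT.
case: i => [|i]; first by rewrite !in_YD.
case: j => [|j]; first by rewrite !in_YD.
by rewrite !YDP sE fE.
Qed.

Lemma restr_ssyt T sigma : ssyt rho T -> ssyt_weight T n' ->
  finsupp (restr N T) = YD sigma -> ssyt sigma (restr N T) /\ ssyt_weight (restr N T) n.
Proof.
move=> [sT rT cT] wT rE.
have inD b : b \in YD sigma -> b \in YD rho /\ restr N T b = T b.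
  rewrite -rE mem_finsupp_restr -sT => /andP[bT Tb]; split => //.
  by rewrite restrE Tb.
split; first split => //.
- by move=> i j j' /inD[D ->] /inD[D' ->]; apply: rT.
- by move=> i i' j /inD[D ->] /inD[D' ->]; apply: cT.
move=> i; have : n i = count (fun b => ((T b).-1 == i) && (T b <= N)%N) (finsupp T).
  case: (ltnP i N) => iN; last first.
    rewrite nN//; apply/esym/eqP; rewrite -leqn0 leqNgt -has_count; apply/hasPn => b bT.
    by move: bT; rewrite mem_finsupp => Tb; lia.
  have := n'E i; rewrite ltn_eqF// => <-; rewrite wT; apply: eq_in_count => b.
  by rewrite mem_finsupp => Tb; lia.
move=> ->.
have -> : count (fun b => (restr N T b).-1 == i) (finsupp (restr N T)) =
    count (fun b => (T b).-1 == i) (finsupp (restr N T)).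
  apply: eq_in_count => b; rewrite mem_finsupp_restr restrE => /andP[_ ->] //.
rewrite -count_filter; apply/permP; apply: uniq_perm; rewrite ?filter_uniq ?fset_uniq//.
by move=> b; rewrite mem_filter [in RHS]mem_finsupp_restr andbC.
Qed.

Hypothesis rhok : sumn rho = (mdeg n + k)%N.

Lemma extend_ssyt T' sigma : sumn sigma = mdeg n -> hstrip rho sigma ->
  ssyt sigma T' -> ssyt_weight T' n ->
  exists2 T, ssyt rho T /\ ssyt_weight T n' & restr N T = T'.
Proof.
move=> ssn /asboolP hs [sT rT cT] wT.
have TN b := ssyt_weight_bound b wT nN.
(* New boxes receive [N + 1], the entry whose variable has index [N]. *)
pose T : filling := [fsfun b in YD rho => if b \in YD sigma then T' b else N.+1].
have sub b : b \in YD sigma -> b \in YD rho.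
  case: b => -[|i] [|j]; rewrite ?in_YD// !add1n /part /= !ltnS => js.
  by have /andP[_] := hs i; apply: leq_trans.
have TE b : b \in YD rho -> T b = if b \in YD sigma then T' b else N.+1.
  by move=> bD; rewrite fsfunE bD.
have fT : finsupp T = YD rho.
  apply/fsetP => b; rewrite mem_finsupp fsfunE; case: ifPn => //.
  by case: ifPn => // bs _; rewrite -mem_finsupp sT bs.
exists T; [split; [split => //|]|].
- move=> i j j' D D' jj'; rewrite !TE//.
  case: (boolP ((i, j') \in YD sigma)) => [s'|_];
    last by case: ifP => // _; apply/leqW/TN.
  have s : (i, j) \in YD sigma.
    by move: s' D; rewrite !in_YD => /and3P[-> _ h] /and3P[_ -> _]; lia.
  by rewrite s; apply: rT.
- move=> i i' j D D' ii'; rewrite !TE//.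
  have s : (i, j) \in YD sigma.
    move: D D'; rewrite !in_YD => /and3P[i0 -> _] /and3P[_ _ h] /=; rewrite i0.
    have /andP[h1 _] := hs i.-1; rewrite /part in h *.
    have := @ip_mono rho i i'.-1; rewrite prednK// in h1; lia.
  rewrite s; case: (boolP ((i', j) \in YD sigma)) => [s'|_]; last by rewrite ltnS TN.
  by apply: cT.
- move=> i; rewrite fT.
  rewrite (permP (_ : perm_eq (YD rho) (YD sigma ++ [seq b <- YD rho | b \notin YD sigma]))); last first.
    apply: uniq_perm; rewrite ?fset_uniq// ?cat_uniq ?filter_uniq ?fset_uniq//=.
      by rewrite andbT; apply/hasPn => b; rewrite mem_filter => /andP[].
    by move=> b; rewrite mem_cat mem_filter; case: (boolP (b \in YD sigma)) => // /sub ->.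
  rewrite count_cat n'E.
  have -> : count (fun b => (T b).-1 == i) (YD sigma) = n i.
    rewrite wT sT; apply: eq_in_count => b bs.
    by rewrite TE ?sub// bs.
  have -> : count (fun b => (T b).-1 == i) [seq b <- YD rho | b \notin YD sigma] =
      ((i == N) * count (fun b => b \notin YD sigma) (YD rho))%N.
    rewrite count_filter; case: (eqVneq i N) => [->|iN] /=; rewrite ?mul1n ?mul0n.
      apply: eq_in_count => b bD /=; rewrite TE//.
      by case: (boolP (b \in YD sigma)) => //= _; rewrite ?andbT ?andbF ?eqxx.
    apply/eqP; rewrite -leqn0 leqNgt -has_count; apply/hasPn => b bD /=.
    by rewrite TE//; case: (b \in YD sigma); rewrite ?andbF//= eq_sym (negPf iN).
  case: (eqVneq i N) => [->|_]; rewrite ?mul0n ?addn0// mul1n nN// add0n.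
  have := count_predC (fun b => b \in YD sigma) (YD rho).
  rewrite (size_diagram (o := fun=> 1%N) (in_YD rho)) rhok.
  have -> : count (fun b => b \in YD sigma) (YD rho) = mdeg n.
    rewrite -ssn -(size_diagram (o := fun=> 1%N) (in_YD sigma)) -size_filter.
    apply: perm_size; apply: uniq_perm; rewrite ?filter_uniq ?fset_uniq// => b.
    by rewrite mem_filter; apply: andb_idr => /sub.
  by move=> /addnI ->.
apply/fsfunP => b; rewrite restrE.
have [bD|bD] := boolP (b \in YD rho).
  rewrite TE//; case: (boolP (b \in YD sigma)) => bs; first by rewrite TN.
  by rewrite ltnn fsfun_dflt// sT.
rewrite (@fsfun_dflt _ _ _ T) ?fT//= fsfun_dflt// sT.
by apply: contra bD; apply: sub.
Qed.

(** Tableaux of shape [rho] are sorted by the shape that their entries at most [N] occupy; on each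
    class restriction is bijective, the other boxes being forced to carry [N + 1]. *)
Lemma schur_branch :
  schur rho n' = \sum_(sigma <- IP (mdeg n) | hstrip rho sigma) schur sigma n.
Proof.
rewrite -[RHS]big_filter.
pose r (T : filling) (sigma : int_partition) := finsupp (restr N T) == YD sigma.
rewrite {1}/schur (@fsum_fiber _ _ _ _ [seq s <- IP (mdeg n) | hstrip rho s] r).
- rewrite big_seq [RHS]big_seq; apply: eq_bigr => sigma.
  rewrite mem_filter mem_IP => /andP[hs /eqP ss].
  rewrite /schur [RHS](@reindex_fsbig _ _ _ _ _ (restr N)
    ([set T | ssyt rho T /\ ssyt_weight T n'] `&` [set T | r T sigma]))//.
  split.
  + by move=> T [[ST wT] /eqP rT]; apply: restr_ssyt.
  + move=> T T'; rewrite !inE => -[[[sT _ _] wT] _] [[[sT' _ _] wT'] _] e.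
    apply/fsfunP => b; have := congr1 (fun f : filling => f b) e; rewrite !restrE.
    have := ssyt_weight_bound b wT n'N; have := ssyt_weight_bound b wT' n'N.
    have : (T b == 0%N) = (T' b == 0%N).
      by apply: negb_inj; rewrite -!mem_finsupp sT sT'.
    by move: (T b) (T' b) => x y; case: (leqP x N); case: (leqP y N); lia.
  + move=> T' [ST' wT']; have [T [ST wT] rT] := extend_ssyt ss hs ST' wT'.
    exists T => //; split=> //; rewrite /r /= rT; by case: ST' => ->.
- exact: finite_ssyt.
- by rewrite filter_uniq ?IP_uniq.
- move=> T [ST wT]; have [sigma hs rE] := restr_shape ST wT.
  exists sigma.
    rewrite mem_filter hs mem_IP; apply/eqP.
    have [[sT' _ _] wT'] := restr_ssyt ST wT rE.
    rewrite /mdeg (mtail_count _ wT') count_predT sT'.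
    by rewrite (size_diagram (o := fun=> 1%N) (in_YD sigma)).
  by move=> sigma' _; rewrite /r rE; apply/eqP/eqP => [/YD_inj|->].
Qed.

End Branching.
End Schur.

(** * The Cauchy kernel *)

(** Together with [kernel_factor_x0] this shows that a nonconstant term of a factor involves both
    variables, which bounds the pairs [(i, j)] used in an expansion with given exponents. *)
Lemma kernel_factor_y0 p : kernel_factor p 0 = (p == 0%N)%:R.
Proof.
rewrite /kernel_factor /xymul; under eq_bigr do rewrite big_ord1 /= andbT mul0r subr0 subnn.
rewrite big_ord_recl /= subn0 mul1r big1 ?addr0// => i _.
by rewrite /= mul0r.
Qed.

Lemma kernel_factor_x0 q : kernel_factor 0 q = (q == 0%N)%:R.
Proof.
rewrite /kernel_factor /xymul big_ord1 /= subn0.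
rewrite big_ord_recl /= mulr0 subr0 mul1r subn0 big1 ?addr0 1?eq_sym// => j _.
by rewrite /= mulr0 subr0 mul0r.
Qed.

Section Kernel.

Definition expansion := {fsfun nat * nat -> nat * nat with (0%N, 0%N)}.
Implicit Types (E : expansion) (m n d : monom).

Definition row_exp E i := (\sum_(ij <- finsupp E | ij.1 == i) (E ij).1)%N.
Definition col_exp E j := (\sum_(ij <- finsupp E | ij.2 == j) (E ij).2)%N.
Definition kterm E : Zbeta := \prod_(ij <- finsupp E) kernel_factor (E ij).1 (E ij).2.

(** Only nonvanishing terms are kept: exponents such as [(p, 0)] could otherwise sit at infinitely
    many [(i, j)], and the index set could be infinite. *)
Definition kset m n : set expansion :=
  [set E | [/\ forall i, m i = row_exp E i, forall j, n j = col_exp E j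
             & kterm E != 0]].

Lemma kernel_kset m n : kernel m n = \sum_(E \in kset m n) kterm E.
Proof.
rewrite /kernel fsbig_supp; apply: eq_fsbigl; apply/seteqP; split=> E /=.
  by move=> [[r c] /eqP k].
by move=> [r c /eqP k].
Qed.

Lemma kterm_neq0 E ij : kterm E != 0 -> ij \in finsupp E ->
  (0 < (E ij).1)%N /\ (0 < (E ij).2)%N.
Proof.
rewrite prodf_seq_neq0 => /allP h ijE; have := h _ ijE; move: ijE.
rewrite mem_finsupp; case: (E ij) => p q /=.
case: p q => [|p] [|q] //= _; first by rewrite kernel_factor_x0 eqxx.
by rewrite kernel_factor_y0 eqxx.
Qed.

Lemma kset_supp m n E ij : kset m n E -> ij \in finsupp E ->
  [/\ (0 < (E ij).1)%N, (0 < (E ij).2)%N, ((E ij).1 <= m ij.1)%N & ((E ij).2 <= n ij.2)%N].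
Proof.
move=> [r c k] ijE; have [h1 h2] := kterm_neq0 k ijE; split=> //.
  by rewrite r; apply: (leq_mem_sum (fun x => (E x).1) ijE).
by rewrite c; apply: (leq_mem_sum (fun x => (E x).2) ijE).
Qed.

Lemma finite_kset m n : finite_set (kset m n).
Proof.
have := @finite_fsfun _ (nat * nat)%type (0%N, 0%N) (finsupp m `*` finsupp n)%fset
  ([fset i | i in iota 0 (mdeg m).+1] `*` [fset i | i in iota 0 (mdeg n).+1])%fset.
apply: sub_finite_set => E kE; split.
  apply/fsubsetP => ij /(kset_supp kE) [h1 h2 h3 h4]; rewrite in_fsetM !mem_finsupp.
  by rewrite -!lt0n (leq_trans h1 h3) (leq_trans h2 h4).
move=> ij _; rewrite in_fsetM !in_fset_iota !ltnS.
have [/(kset_supp kE) [_ _ h3 h4]|ijE] := boolP (ij \in finsupp E); last first.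
  by rewrite fsfun_dflt.
by rewrite (leq_trans h3)/= ?(leq_trans h4) ?monom_le_deg.
Qed.

Definition epart (p : pred (nat * nat)) E : expansion :=
  [fsfun ij in finsupp E => if p ij then E ij else (0%N, 0%N)].

Lemma epartE p E ij : epart p E ij = if p ij then E ij else (0%N, 0%N).
Proof. by rewrite fsfunE; case: ifPn => // ijE; rewrite fsfun_dflt//; case: ifP. Qed.

Lemma big_epart (R : Type) (idx : R) (op : Monoid.com_law idx) p E
    (P : pred (nat * nat)) (F : nat * nat -> R) :
  \big[op/idx]_(ij <- finsupp (epart p E) | P ij) F (epart p E ij) =
  \big[op/idx]_(ij <- finsupp E | P ij && p ij) F (E ij).
Proof.
rewrite (perm_big [seq ij <- finsupp E | p ij]); last first.
  apply: uniq_perm; rewrite ?filter_uniq ?fset_uniq// => ij.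
  by rewrite mem_filter !mem_finsupp epartE; case: (p ij); rewrite ?eqxx.
rewrite big_filter_cond; under eq_bigl do rewrite andbC.
by apply: eq_bigr => ij /andP[_ pij]; rewrite epartE pij.
Qed.

Lemma big_epart_split (R : Type) (idx : R) (op : Monoid.com_law idx) p E
    (P : pred (nat * nat)) (F : nat * nat -> R) :
  \big[op/idx]_(ij <- finsupp E | P ij) F (E ij) =
  op (\big[op/idx]_(ij <- finsupp (epart p E) | P ij) F (epart p E ij))
     (\big[op/idx]_(ij <- finsupp (epart (predC p) E) | P ij) F (epart (predC p) E ij)).
Proof. by rewrite (bigID p) !big_epart. Qed.

Lemma row_exp_split p E i :
  row_exp E i = (row_exp (epart p E) i + row_exp (epart (predC p) E) i)%N.
Proof. exact: (@big_epart_split _ _ _ p E _ fst). Qed.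

Lemma col_exp_split p E i :
  col_exp E i = (col_exp (epart p E) i + col_exp (epart (predC p) E) i)%N.
Proof. exact: (@big_epart_split _ _ _ p E _ snd). Qed.

Lemma kterm_split p E : kterm E = kterm (epart p E) * kterm (epart (predC p) E).
Proof. exact: (@big_epart_split _ _ _ p E _ (fun x => kernel_factor x.1 x.2)). Qed.

Definition row_monom E : monom :=
  [fsfun i in [fset ij.1 | ij in finsupp E]%fset => row_exp E i].

Lemma row_monomE E i : row_monom E i = row_exp E i.
Proof.
rewrite fsfunE; case: ifPn => // iE; rewrite /row_exp big_seq_cond big1// => ij.
move=> /andP[ijE /eqP iji]; case/negP: iE; apply/imfsetP.
by exists ij.
Qed.

(** An expansion splits into its factors involving [y_N] and the others. As [n N = 0], the column
    exponents separate, and [d] records the monomial in [x] of the first part. *)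
Lemma kernel_add m n N k : n N = 0%N ->
  kernel m (madd n (msingle N k)) =
  smul (kernel^~ (msingle N k)) (kernel^~ n) m.
Proof.
move=> nN; set n' := madd _ _; pose p (ij : nat * nat) := ij.2 == N.
rewrite kernel_kset.
pose r E d := row_monom (epart p E) == d.
rewrite (@fsum_fiber _ _ _ _ (mdivs m) r); last first.
- move=> E [rE _ _]; exists (row_monom (epart p E)); last first.
    by move=> d _; rewrite /r eq_sym.
  by apply/mdivsP => i; rewrite row_monomE rE (row_exp_split p E) leq_addr.
- exact: mdivs_uniq.
- exact: finite_kset.
rewrite smulE big_seq [RHS]big_seq; apply: eq_bigr => d /mdivsP dm.
rewrite !kernel_kset fsum_prod; [|exact: finite_kset..].
rewrite [RHS](@reindex_fsbig _ _ _ _ _ (fun E => (epart p E, epart (predC p) E))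
  (kset m n' `&` [set E | r E d])).
  by apply: eq_fsbigr => E _; rewrite /= (kterm_split p E).
have colp E j : col_exp (epart p E) j = if j == N then col_exp E N else 0%N.
  rewrite /col_exp (@big_epart _ _ _ p E _ snd); case: eqP => [->|jN].
    by apply: eq_bigl => ij; rewrite /p andbb.
  by rewrite big1// => ij /andP[/eqP e1 /eqP e2]; case: jN; rewrite -e1.
have colNp E j : col_exp (epart (predC p) E) j = if j == N then 0%N else col_exp E j.
  rewrite /col_exp (@big_epart _ _ _ (predC p) E _ snd); case: eqP => [->|jN].
    by rewrite big1// => ij /andP[/eqP e]; rewrite /= /p e eqxx.
  by apply: eq_bigl => ij; rewrite /= /p; case: eqP => [->|]//; rewrite (introF eqP jN).
split.
- move=> E [[rE cE kE] /eqP rEd] /=.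
  have kE2 : kterm (epart p E) != 0 /\ kterm (epart (predC p) E) != 0.
    by move: kE; rewrite (kterm_split p E) mulf_eq0 negb_or => /andP.
  split; split; try by case: kE2.
  + by move=> i; rewrite -rEd row_monomE.
  + move=> j; rewrite colp msingleE; case: eqP => // _.
    by rewrite -cE maddE nN msingleE eqxx.
  + by move=> i; rewrite msubE rE (row_exp_split p E) -rEd row_monomE addKn.
  + move=> j; rewrite colNp; case: eqP => [->//|/eqP/negPf jN].
    by rewrite -cE maddE msingleE jN addn0.
- move=> E E' _ _ [/fsfunP e1 /fsfunP e2]; apply/fsfunP => ij.
  have := e1 ij; have := e2 ij; rewrite !epartE /=.
  by case: (p ij).
- move=> [E1 E2] [/= kE1 kE2].
  have s1 ij : ij \in finsupp E1 -> p ij.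
    move=> /(kset_supp kE1)[_ h _]; rewrite msingleE /p; case: eqP => // _.
    by rewrite leqNgt h.
  have s2 ij : ij \in finsupp E2 -> ~~ p ij.
    move=> /(kset_supp kE2)[_ h _]; rewrite /p; case: eqP => // ->.
    by rewrite nN leqNgt h.
  pose E : expansion := [fsfun ij in (finsupp E1 `|` finsupp E2)%fset =>
    if p ij then E1 ij else E2 ij].
  have EE ij : E ij = if p ij then E1 ij else E2 ij.
    rewrite fsfunE inE; case: ifPn => //; rewrite negb_or => /andP[h1 h2].
    by rewrite !fsfun_dflt//; case: ifP.
  have pE1 : epart p E = E1.
    apply/fsfunP => ij; rewrite epartE EE; case: (boolP (p ij)) => // np.
    by rewrite fsfun_dflt//; apply: contra np; apply: s1.
  have pE2 : epart (predC p) E = E2.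
    apply/fsfunP => ij; rewrite epartE EE /=; case: (boolP (p ij)) => //= np.
    by rewrite fsfun_dflt//; apply/negP => /s2; rewrite np.
  have [r1 c1 k1] := kE1; have [r2 c2 k2] := kE2.
  exists E; last by rewrite pE1 pE2.
  split; last by rewrite /= /r pE1; apply/eqP/fsfunP => i; rewrite row_monomE r1.
  split.
  + by move=> i; rewrite (row_exp_split p E) pE1 pE2 -r1 -r2 msubE subnKC.
  + by move=> j; rewrite (col_exp_split p E) pE1 pE2 -c1 -c2 maddE addnC.
  + by rewrite (kterm_split p E) pE1 pE2 mulf_neq0.
Qed.

Lemma kernel0 m : kernel m mzero = sone m.
Proof.
have kE m' E : kset m' mzero E -> E = [fsfun].
  move=> k; apply/fsfunP => ij; rewrite fsfun0E fsfun_dflt//; apply/negP.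
  by move=> /(kset_supp k)[_ h _]; rewrite mzeroE leqNgt h.
rewrite kernel_kset /sone; case: eqP => [->|m0].
  rewrite (_ : kset mzero mzero = [set [fsfun]]).
    by rewrite fsbig_set1 /kterm finsupp0 big_nil.
  apply/seteqP; split=> E; last first.
    move=> ->; split; rewrite /row_exp /col_exp /kterm ?finsupp0 ?big_nil ?oner_eq0//;
    by move=> i; rewrite mzeroE big_nil.
  exact: kE.
rewrite fsbig1// => E k; exfalso; apply: m0; apply/fsfunP => i.
by have [-> _ _] := k; rewrite (kE _ _ k) /row_exp finsupp0 big_nil mzeroE.
Qed.

End Kernel.

(** * Set-valued shifted tableaux *)

Lemma var_index_double i : var_index i.*2 = i.-1.
Proof. by rewrite /var_index; lia. Qed.

(** * Strict partitions and lower bounds for tableau entries *)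

Section StrictPartitions.
Implicit Types la mu : strict_partition.

Lemma sp_pos la : 0%N \notin (la : seq nat).
Proof. by case: la => s /= /andP[]. Qed.

Lemma sp_ext la mu : (forall i, nth 0 la i = nth 0 mu i)%N -> la = mu.
Proof. by move=> h; apply/val_inj/eq_from_nth_pos => //=; apply: sp_pos. Qed.

Lemma sp_strict la i : (0 < nth 0 la i.+1)%N -> (nth 0 la i.+1 < nth 0 la i)%N.
Proof.
move=> pos; have iS : (i.+1 < size la)%N.
  by rewrite ltnNge; apply: contraL pos => h; rewrite nth_default.
by case: la iS {pos} => s /= /andP[/(sortedP 0%N) ss _] /ss.
Qed.

Lemma sp_nth_gt0 la i : (i < size la)%N -> (0 < nth 0 la i)%N.
Proof.
move=> il; rewrite lt0n; apply: contra (sp_pos la) => /eqP <-.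
exact: mem_nth.
Qed.

Definition SP (d : nat) : seq strict_partition :=
  fset_set [set la : strict_partition | (sumn la <= d)%N].

Lemma mem_SP d la : (la \in SP d) = (sumn la <= d)%N.
Proof.
rewrite /SP in_fset_set; first by apply/idP/idP; rewrite inE.
exact: (@finite_pos_seq strict_partition strict_parts d val_inj sp_pos).
Qed.

Lemma SP_uniq d : uniq (SP d).
Proof. exact: fset_uniq. Qed.

Definition sp_nil : strict_partition := @StrictPartition [::] isT.

Lemma SD_nil : SD sp_nil = fset0.
Proof.
apply/fsetP => -[i j]; rewrite in_SD inE /part nth_nil addn0.
by apply/negP => /and3P[_]; rewrite leqNgt => /negP.
Qed.

Lemma SDskew_nil la : SDskew la sp_nil = SD la.
Proof. by rewrite /SDskew SD_nil fsetD0. Qed.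

Lemma SD_diag la i j : (i, j) \in SD la -> (i, i) \in SD la.
Proof. by rewrite !in_SD => /and3P[-> ij jl]; rewrite leqnn /=; lia. Qed.

(* Three boxes (i,i), (i,i+1), (i+1,i+1) cannot share the two codes of a
   variable, so going down the diagonal increases the variable. *)
Lemma shifted_entry_ge la (X : box -> nat -> Prop) :
  (forall b, b \in SD la -> exists k, X b k) ->
  (forall b k, b \in SD la -> X b k -> (0 < k)%N) ->
  (forall i j j' k k', (i, j) \in SD la -> (i, j') \in SD la -> (j < j')%N ->
     X (i, j) k -> X (i, j') k' -> (k <= k')%N) ->
  (forall i i' j k k', (i, j) \in SD la -> (i', j) \in SD la -> (i < i')%N ->
     X (i, j) k -> X (i', j) k' -> (k <= k')%N) ->
  (forall i j j' k, (i, j) \in SD la -> (i, j') \in SD la -> j <> j' ->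
     X (i, j) k -> X (i, j') k -> ~~ primed k) ->
  (forall i i' j k, (i, j) \in SD la -> (i', j) \in SD la -> i <> i' ->
     X (i, j) k -> X (i', j) k -> primed k) ->
  forall i j k, (i, j) \in SD la -> X (i, j) k -> (i.-1 <= var_index k)%N.
Proof.
move=> Xex X0 Xrow Xcol Xr Xc.
(* In doubled codes: the diagonal entry of row [i + 1] is at least [(i + 1)'], whose code is
   [2 i + 1]. *)
have diag i k : (i.+1, i.+1) \in SD la -> X (i.+1, i.+1) k -> (i.*2 < k)%N.
  elim: i k => [|i IHi] k D Xk; first exact: X0 Xk.
  have [D1 D2] : (i.+1, i.+1) \in SD la /\ (i.+1, i.+2) \in SD la.
    by move: D; rewrite !in_SD /part /=; have := @sp_strict la i; lia.
  have [a Xa] := Xex _ D1; have [b Xb] := Xex _ D2.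
  have ka := IHi a D1 Xa.
  have ab : (a <= b)%N by apply: Xrow Xa Xb.
  have bk : (b <= k)%N by apply: Xcol Xb Xk.
  (* Otherwise [a <= b <= k] all lie among the two codes [2 i + 1] and [2 i + 2]: a primed [b] then
     equals [a] in its row, and an unprimed [b] equals [k] in its column. *)
  rewrite doubleS ltnNge; apply/negP => kS.
  have [bodd|beven] : (b = i.*2.+1 \/ b = i.*2.+2)%N by lia.
    have aE : a = b by lia.
    rewrite aE in Xa; have nj : i.+1 <> i.+2 by lia.
    by have := Xr _ _ _ _ D1 D2 nj Xa Xb; rewrite /primed bodd /= odd_double.
  have kE : k = b by lia.
  rewrite kE in Xk; have ni : i.+1 <> i.+2 by lia.
  by have := Xc _ _ _ _ D2 D ni Xb Xk; rewrite /primed beven /= odd_double.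
move=> [|i] j k D Xk //=; have Dii := SD_diag D.
have [k0 Xk0] := Xex _ Dii; have := diag _ _ Dii Xk0; rewrite /var_index.
have [ij|ji] := ltnP i.+1 j; first by have := Xrow _ _ _ _ _ Dii D ij Xk0 Xk; lia.
have jE : j = i.+1 by move: (D); rewrite in_SD => /and3P[_ ij _]; apply/eqP; rewrite eqn_leq ji.
by rewrite jE in D Xk; have := diag _ _ D Xk; lia.
Qed.

End StrictPartitions.

Section SetValued.
Implicit Types (la : strict_partition) (T : sv_filling) (m : monom).

Lemma sv_entry_ge la T i j k : sv_tableau la T -> k \in T (i, j) ->
  (i.-1 <= var_index k)%N.
Proof.
move=> [sT T0 [Tr Tc] Tcp Trp] kT.
apply: (@shifted_entry_ge la (fun b k => k \in T b)); last exact: kT.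
- by move=> b; rewrite -sT mem_finsupp => /fset0Pn.
- by move=> b k' _ k'T; rewrite lt0n; apply: contra (T0 b) => /eqP <-.
- by move=> ? ? ? ? ? _ _ jj'; apply: Tr.
- by move=> ? ? ? ? ? _ _ ii'; apply: Tc.
- by move=> ? ? ? ? _ _; apply: Trp.
- by move=> ? ? ? ? _ _; apply: Tcp.
- by rewrite -sT mem_finsupp; apply/fset0Pn; exists k.
Qed.

Lemma sv_weight_flatten T m : sv_weight T m ->
  forall i, m i = count (fun k => var_index k == i)
    (flatten [seq (T b : seq nat) | b <- finsupp T]).
Proof. by move=> w i; rewrite w count_flatten sumnE !big_map. Qed.

(** The boxes are nonempty, so each box below row [k] contributes an element whose variable has
    index at least [k]. *)
Lemma sv_tail la T m k : sv_tableau la T -> sv_weight T m ->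
  (sumn (drop k la) <= mtail k m)%N.
Proof.
move=> tT /sv_weight_flatten w; rewrite (mtail_count _ w) count_flatten [leqRHS]sumnE !big_map.
rewrite -(count_rows_gt (o := id) (in_SD la)) count_sum.
have [sT _ _ _ _] := tT; rewrite sT [leqLHS]big_seq [leqRHS]big_seq.
apply: leq_sum => -[i j] bD /=; case: (ltnP k i) => // ki.
move: bD; rewrite -sT mem_finsupp => /fset0Pn[x xT] /=.
rewrite -has_count; apply/hasP; exists x => //.
exact: leq_trans (leq_pred_ltn ki (leqnn i)) (sv_entry_ge tT xT).
Qed.

Lemma finite_sv la m : finite_set [set T | sv_tableau la T /\ sv_weight T m].
Proof.
have [B mB] := monom_bound m.
have := @finite_fsfun box {fset nat} fset0 (SD la)
  (fpowerset [fset i | i in iota 0 B.*2.+1]%fset).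
apply: sub_finite_set => T [[sT _ _ _ _] wT]; split; first by rewrite sT.
move=> b bD; rewrite fpowersetE; apply/fsubsetP => k kT; rewrite in_fset_iota.
have : (var_index k < B)%N.
  rewrite ltnNge; apply/negP => /mB; rewrite wT => /eqP.
  rewrite sum_nat_seq_eq0 => /allP /(_ b); rewrite sT bD => /(_ isT) /=.
  by rewrite -leqn0 leqNgt -has_count => /negP[]; apply/hasP; exists k.
by rewrite /var_index; lia.
Qed.

Lemma sv_canonical la : exists T,
  [/\ sv_tableau la T, sv_Ptype T & sv_weight T (mseq la)].
Proof.
(* Row [i] is filled with the singleton of the unprimed [i], coded [2 i]. *)
pose T : sv_filling := [fsfun b in SD la => [fset b.1.*2]%fset].
have TE b k : k \in T b -> b \in SD la /\ k = b.1.*2.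
  by rewrite fsfunE; case: ifP => // bD; rewrite inE => /eqP.
have sT : finsupp T = SD la.
  apply/fsetP => b; rewrite mem_finsupp fsfunE; case: ifP => // bD.
  by apply/fset0Pn; exists b.1.*2; rewrite inE.
exists T; split.
- split => //.
  + move=> [i j]; apply/negP => /TE[]; rewrite in_SD => /andP[i0 _] /=; lia.
  + split=> [i j j' _ k k' /TE[_ ->] /TE[_ ->]//|i i' j ii' k k' /TE[_ ->] /TE[_ ->] /=].
    by rewrite leq_double ltnW.
  + by move=> i i' j k ii' /TE[_ ->] /TE[_ /= /double_inj].
  + by move=> i j j' k _ /TE[_ ->] _; rewrite /primed odd_double.
- by move=> j k /TE[_ ->]; rewrite /primed odd_double.
move=> i; rewrite mseqE sT -(count_row_eq (o := id) (in_SD la)) count_sum.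
rewrite big_seq [RHS]big_seq; apply: eq_bigr => b bD; rewrite fsfunE bD.
rewrite count_fset1; congr nat_of_bool; congr (_ == _).
by rewrite var_index_double.
Qed.

Lemma horner_betaX k : ((beta : {poly int}) ^+ k).[1] = 1.
Proof. by rewrite hornerXn expr1n. Qed.

(** At [beta = 1] every tableau contributes 1, so nothing cancels. *)
Lemma GQ_diag la : GQ la (mseq la) != 0.
Proof.
apply: (@fsum_neq0 _ _ _ 1); first exact: finite_sv; last by move=> *; apply: horner_betaX.
by have [T [? ? ?]] := sv_canonical la; exists T.
Qed.

Lemma GP_diag la : GP la (mseq la) != 0.
Proof.
apply: (@fsum_neq0 _ _ _ 1); last by move=> *; apply: horner_betaX.
  by apply: sub_finite_set (@finite_sv la (mseq la)) => T [].
by have [T ?] := sv_canonical la; exists T.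
Qed.

Lemma GQ_tail la m k : GQ la m != 0 -> (sumn (drop k la) <= mtail k m)%N.
Proof. by move=> /fsum_ex[T [? ?]]; apply: (@sv_tail la T). Qed.

Lemma GP_tail la m k : GP la m != 0 -> (sumn (drop k la) <= mtail k m)%N.
Proof. by move=> /fsum_ex[T [? ? ?]]; apply: (@sv_tail la T). Qed.

Lemma sv_nil T m : sv_tableau sp_nil T -> sv_weight T m -> T = [fsfun] /\ m = mzero.
Proof.
move=> [sT _ _ _ _] wT; split.
  by apply/fsfunP => b; rewrite fsfun0E fsfun_dflt// sT SD_nil.
by apply/fsfunP => i; rewrite wT sT SD_nil big_nil mzeroE.
Qed.

Lemma sv_nilP : [/\ sv_tableau sp_nil [fsfun], sv_Ptype [fsfun] & sv_weight [fsfun] mzero].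
Proof.
have [T [tT pT wT]] := sv_canonical sp_nil.
have [TE mE] := sv_nil tT wT; rewrite TE in tT pT wT; split=> //.
by move: wT; rewrite mE.
Qed.

Lemma GQ_nil : GQ sp_nil = sone.
Proof.
apply/funext => m; rewrite /GQ /sone; case: eqP => [->|m0]; last first.
  by rewrite fsbig1// => T [tT wT]; have [_ /m0] := sv_nil tT wT.
have [tT pT wT] := sv_nilP.
rewrite (_ : [set T | _] = [set [fsfun]]).
  by rewrite fsbig_set1 /sv_size finsupp0 big_nil expr0.
by apply/seteqP; split=> [T [tT' wT']|T ->//]; have [] := sv_nil tT' wT'.
Qed.

Lemma GP_nil : GP sp_nil = sone.
Proof.
apply/funext => m; rewrite /GP /sone; case: eqP => [->|m0]; last first.
  by rewrite fsbig1// => T [tT _ wT]; have [_ /m0] := sv_nil tT wT.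
have [tT pT wT] := sv_nilP.
rewrite (_ : [set T | _] = [set [fsfun]]).
  by rewrite fsbig_set1 /sv_size finsupp0 big_nil expr0.
by apply/seteqP; split=> [T [tT' _ wT']|T ->//]; have [] := sv_nil tT' wT'.
Qed.

End SetValued.

(** * Shifted bar tableaux *)

Section BarTableaux.
Implicit Types (la : strict_partition) (T : bar_filling) (w : seq nat).

Lemma bar_entry_ge la T i j : ShBTQ la sp_nil T -> (i, j) \in SD la ->
  (i.-1 <= var_index (T.1 (i, j)))%N.
Proof.
move=> [[]]; rewrite SDskew_nil => sT Tr Tc Trp Tcp _ _ D.
apply: (@shifted_entry_ge la (fun b k => T.1 b = k)) D _ => //.
- by move=> b _; exists (T.1 b).
- by move=> b k; rewrite -sT mem_finsupp lt0n => + <-.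
- by move=> ? ? ? ? ? D D' jj' <- <-; apply: Tr.
- by move=> ? ? ? ? ? D D' jj' <- <-; apply: Tc.
- by move=> ? ? ? ? D D' jj' <- e; apply: Trp D D' jj' (esym e).
- by move=> ? ? ? ? D D' jj' <- e; apply: Tcp D D' jj' (esym e).
Qed.

(** A block whose variable has index below [k] has a box in the first [k] rows, and blocks are
    disjoint. Head sums replace tail sums here because bars can lower the degree below [|la|],
    whereas in [GP] and [GQ] the degree can only grow. *)
Lemma bar_head la T w k : ShBTQ la sp_nil T -> bar_weight T (mseq w) ->
  (sumn (take k w) <= sumn (take k la))%N.
Proof.
move=> tT wT; have [_ + Tbl] := tT; rewrite SDskew_nil => -[P0 Ptriv Pcov].
rewrite (@sumn_nth _ k) ?size_take_min ?geq_minl//.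
rewrite big_nat_cond (eq_bigr (fun i => count (fun B : {fset box} =>
    has (fun b => var_index (T.1 b) == i) B) T.2)); last first.
  by move=> i /andP[/andP[_ ik] _]; rewrite nth_take// -mseqE wT.
rewrite -big_nat_cond -(count_rows_le (o := id) (in_SD la)).
under eq_bigr do rewrite count_sum.
rewrite exchange_big /= count_sum -Pcov big_trivIfset//.
rewrite [leqLHS]big_seq [leqRHS]big_seq; apply: leq_sum => B BP.
have [_ Bc] := Tbl _ BP.
have [|[i j] b0B] := fset0Pn B _; first by apply: contraNneq P0 => <-.
have bD : (i, j) \in SD la by rewrite -Pcov; apply/bigfcupP; exists B; rewrite ?BP.
(* The filling is constant on the block, so the block counts for exactly one variable, that of its
   box [(i, j)]. *)
rewrite (eq_bigr (fun k' => (k' == var_index (T.1 (i, j))) : nat)); last first.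
  move=> k' _; congr nat_of_bool; apply/hasP/eqP => [[b bB /eqP <-]|->].
    by rewrite (Bc b (i, j)).
  by exists (i, j).
rewrite -count_sum count_uniq_mem ?iota_uniq// mem_index_iota /=.
case: ltnP => //= vk; rewrite -count_sum -has_count; apply/hasP; exists (i, j) => //=.
have := leq_ltn_trans (bar_entry_ge tT bD) vk.
by move: bD; rewrite in_SD => /andP[i0 _]; move: i0; case: (i).
Qed.

(** The last diagonal box already carries a variable of index at least [size la - 1]. *)
Lemma bar_size la T w : ShBTQ la sp_nil T -> bar_weight T (mseq w) ->
  (size la <= size w)%N.
Proof.
move=> tT wT; have [l0|l0] := posnP (size la); first by rewrite l0.
have [_ + Tbl] := tT; rewrite SDskew_nil => -[P0 Ptriv Pcov].
have bD : (size la, size la) \in SD la.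
  rewrite in_SD l0 leqnn /= -addn1 leq_add2l /part; apply: sp_nth_gt0; lia.
have := bD; rewrite -Pcov => /bigfcupP[B /andP[BP _] bB].
have : (0 < nth 0 w (var_index (T.1 (size la, size la))))%N.
  rewrite -mseqE wT -has_count; apply/hasP; exists B => //.
  by apply/hasP; exists (size la, size la).
move=> vw; have := bar_entry_ge tT bD.
have : (var_index (T.1 (size la, size la)) < size w)%N.
  by rewrite ltnNge; apply: contraL vw => h; rewrite nth_default.
by move: (var_index _) => v; lia.
Qed.

Lemma bar_canonical la : exists T, ShBTP la sp_nil T /\ bar_weight T (mseq la).
Proof.
pose V : filling := [fsfun b in SD la => b.1.*2].
pose P : {fset {fset box}} := [fset [fset b]%fset | b in SD la]%fset.
have VE b : b \in SD la -> V b = b.1.*2 by move=> bD; rewrite fsfunE bD.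
have sV : finsupp V = SD la.
  apply/fsetP => -[i j]; rewrite mem_finsupp fsfunE; case: ifPn => //.
  by rewrite in_SD => /andP[] /=; case: (i).
have PP B : B \in P -> exists2 b, b \in SD la & B = [fset b]%fset.
  by move=> /imfsetP[b bD ->]; exists b.
exists (V, P); split; [split; [split|]|]; rewrite ?SDskew_nil.
- rewrite /shifted_tableau SDskew_nil; split=> //.
  + by move=> i j j' D D' _; rewrite !VE.
  + by move=> i i' j D D' ii'; rewrite !VE//= leq_double ltnW.
  + by move=> i j j' D D' _ _; rewrite !VE// /primed odd_double.
  + by move=> i i' j D D' ii'; rewrite !VE//= => /double_inj.
- split.
  + apply/negP => /PP[b _ /fsetP /(_ b)]; by rewrite !inE eqxx.
  + apply/trivIfsetP => A B /PP[a _ ->] /PP[b _ ->] ab.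
    by rewrite fdisjointX1 inE eq_sym; apply: contraNneq ab => ->.
  + apply/fsetP => b; apply/bigfcupP/idP => [[B /andP[/PP[a aD ->] _]]|bD].
      by rewrite inE => /eqP->.
    by exists [fset b]%fset; rewrite ?inE// andbT; apply/imfsetP; exists b.
- move=> B /PP[[i j] _ ->]; split; last by move=> b b'; rewrite !inE => /eqP-> /eqP->.
  exists i, j, 1%N; left; apply/fsetP => b; rewrite inE.
  apply/eqP/imfsetP => [->|[t /= + ->]].
    by exists 0%N; rewrite //= addn0.
  by rewrite mem_seq1 => /eqP->; rewrite addn0.
- by move=> j D; rewrite VE// /primed odd_double.
move=> i; rewrite mseqE /= -(count_row_eq (o := id) (in_SD la)).
have perm : perm_eq P [seq [fset b]%fset | b <- SD la].
  by apply: enum_imfset => b b' _ _ /fsetP /(_ b); rewrite !inE eqxx => /esym/eqP.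
rewrite (permP perm) count_map; apply: eq_in_count => b bD /=.
have -> : has (fun b => var_index (V b) == i) [fset b]%fset = (var_index (V b) == i).
  by rewrite has_count count_fset1; case: eqP.
by rewrite VE// var_index_double.
Qed.

Lemma finite_bar la m : finite_set [set T | ShBTQ la sp_nil T /\ bar_weight T m].
Proof.
have [B mB] := monom_bound m.
pose F := [set f : filling | (finsupp f `<=` SD la)%fset /\
  forall x, x \in SD la -> f x \in [fset i | i in iota 0 B.*2.+1]%fset].
have fF : finite_set F by exact: finite_fsfun.
have fP := finite_fset (fpowerset (fpowerset (SD la))).
apply: sub_finite_set (finite_setX fF fP) => -[V P] [[[]]].
rewrite SDskew_nil /= => sV _ _ _ _ [P0 Ptriv Pcov] Pc wT; split=> /=.
  split=> [|b bD]; first by rewrite sV.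
  rewrite in_fset_iota; move: bD; rewrite -Pcov => /bigfcupP[A /andP[AP _] bA].
  have : (var_index (V b) < B)%N.
    rewrite ltnNge; apply/negP => /mB; rewrite wT => /eqP.
    rewrite -leqn0 leqNgt -has_count => /negP[]; apply/hasP; exists A => //.
    by apply/hasP; exists b => /=.
  by rewrite /var_index; move: (V b) => v; lia.
rewrite fpowersetE; apply/fsubsetP => A AP; rewrite fpowersetE.
by apply/fsubsetP => b bA; rewrite -Pcov; apply/bigfcupP; exists A; rewrite ?AP.
Qed.

Lemma horner_NbetaX k : ((- beta : {poly int}) ^+ k).[-1] = 1.
Proof. by rewrite horner_exp hornerN hornerX opprK expr1n. Qed.

(** Evaluation at [beta = -1] turns every [(- beta) ^+ k] into 1. *)
Lemma bar_diagQ la : bar_series (ShBTQ la sp_nil) la sp_nil (mseq la) != 0.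
Proof.
apply: (@fsum_neq0 _ _ _ (-1)); [exact: finite_bar| |by move=> *; apply: horner_NbetaX].
by have [T [[? ?] ?]] := bar_canonical la; exists T.
Qed.

Lemma bar_diagP la : bar_series (ShBTP la sp_nil) la sp_nil (mseq la) != 0.
Proof.
apply: (@fsum_neq0 _ _ _ (-1)); [| |by move=> *; apply: horner_NbetaX].
  by apply: sub_finite_set (@finite_bar la (mseq la)) => T [[? ?] ?].
by have [T ?] := bar_canonical la; exists T.
Qed.

End BarTableaux.

(** * Multiplicativity and duality *)

Section SchurPairing.
Implicit Types (c : int_partition -> Zbeta) (n : monom).

(** The coefficient at [n] of the formal sum of the [c rho] times [schur rho]. Schur functions are
    homogeneous, so restricting to size [mdeg n] loses nothing and [c] may have infinite support.
    [pairS'] is the image under [omega], extended to such sums. *)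
Definition pairS c n : Zbeta := \sum_(rho <- IP (mdeg n)) c rho * schur rho n.
Definition pairS' c n : Zbeta :=
  \sum_(rho <- IP (mdeg n)) c rho * schur (conj_partition rho) n.

Lemma pairS_add c n N k : (forall i, (N <= i)%N -> n i = 0%N) ->
  pairS c (madd n (msingle N k)) = pairS (hop k c) n.
Proof.
move=> nN; rewrite /pairS mdeg_add mdeg_single.
transitivity (\sum_(rho <- IP (mdeg n + k)) \sum_(sigma <- IP (mdeg n) | hstrip rho sigma)
    c rho * schur sigma n).
  rewrite big_seq [RHS]big_seq; apply: eq_bigr => rho; rewrite mem_IP => /eqP sr.
  by rewrite schur_branch// mulr_sumr.
rewrite (exchange_big_dep xpredT)//= big_seq [RHS]big_seq; apply: eq_bigr => sigma.
by rewrite mem_IP => /eqP ss; rewrite /hop ss mulr_suml.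
Qed.

Lemma pairS'_add c n N k : (forall i, (N <= i)%N -> n i = 0%N) ->
  pairS' c (madd n (msingle N k)) = pairS' (eop k c) n.
Proof.
move=> nN; rewrite /pairS' mdeg_add mdeg_single.
transitivity (\sum_(rho <- IP (mdeg n + k)) \sum_(sigma <- IP (mdeg n) | vstrip rho sigma)
    c rho * schur (conj_partition sigma) n).
  rewrite big_seq [RHS]big_seq; apply: eq_bigr => rho; rewrite mem_IP => /eqP sr.
  rewrite schur_branch ?sumn_conj// mulr_sumr.
  rewrite (perm_big [seq conj_partition s | s <- IP (mdeg n)]) /=; last first.
    apply: uniq_perm; rewrite ?IP_uniq// ?map_inj_uniq ?IP_uniq//; first exact: inv_inj conjK.
    move=> s; rewrite -{2}[s]conjK (mem_map (inv_inj conjK)) !mem_IP.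
    by rewrite sumn_conj.
  by rewrite big_map; apply: eq_bigl => s; rewrite hstrip_conj.
rewrite (exchange_big_dep xpredT)//= big_seq [RHS]big_seq; apply: eq_bigr => sigma.
by rewrite mem_IP => /eqP ss; rewrite /eop ss mulr_suml.
Qed.

Lemma pairS_inj c1 c2 : (forall w, pairS c1 (mseq w) = pairS c2 (mseq w)) -> c1 =1 c2.
Proof.
move=> h rho; apply/eqP; rewrite -subr_eq0; apply/eqP.
apply: (@schur_free (fun r => c1 r - c2 r) (sumn rho)) => // w sw.
have := h w; rewrite /pairS mdeg_seq sw => /eqP; rewrite -subr_eq0 => /eqP e.
by rewrite -[RHS]e -sumrB; apply: eq_bigr => r _; rewrite mulrBl.
Qed.

Lemma pairS0 c : pairS' c mzero = pairS c mzero.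
Proof.
rewrite /pairS /pairS' big_seq [RHS]big_seq; apply: eq_bigr => rho.
rewrite mem_IP -mseq_nil mdeg_seq /= => /eqP sr; congr (_ * schur _ _).
apply: ip_ext => i; apply/eqP; rewrite eqn_leq.
have := nth_le_sumn rho i; have := nth_le_sumn (conj_partition rho) i.
by rewrite sumn_conj sr; lia.
Qed.

Lemma omega_graph_pair (f g : series) : omega_graph f g ->
  exists c, f = pairS c /\ g = pairS' c.
Proof.
move=> [s [c [-> ->]]].
(* The list [s] may repeat a partition, so its coefficients are added up. *)
exists (fun rho => \sum_(la <- s | la == rho) c la).
have gen (F : int_partition -> Zbeta) d : (forall la, F la != 0 -> sumn la = d) ->
    \sum_(la <- s) c la * F la =
    \sum_(rho <- IP d) (\sum_(la <- s | la == rho) c la) * F rho.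
  move=> Fd; under [RHS]eq_bigr do rewrite mulr_suml.
  rewrite [RHS](exchange_big_dep xpredT)//=; apply: eq_bigr => la _.
  have [F0|/Fd sd] := eqVneq (F la) 0.
    by rewrite F0 mulr0 big1// => rho /eqP <-; rewrite F0 mulr0.
  by rewrite (@big_unique _ _ _ _ la) ?IP_uniq ?mem_IP ?sd// => rho _ /eqP.
split; apply/funext => m.
  by rewrite /pairS; apply: gen => la /schur_deg.
by rewrite /pairS'; apply: (gen (fun la => schur (conj_partition la) m)) => la /schur_deg <-; rewrite sumn_conj.
Qed.

End SchurPairing.

Lemma mulr_betaX_eq0 (z : int) k : (z%:~R : Zbeta) * beta ^+ k = 0 -> z = 0.
Proof.
move=> /eqP; rewrite mulf_eq0 expf_eq0 polyX_eq0 andbF orbF => /eqP.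
by move=> /(congr1 (horner_eval (0 : int))); rewrite rmorph_int rmorph0 intz.
Qed.

(** * Vanishing of the structure constants for a triangular pair of families [G] and [J] *)

Section Duality.
Variables (G J g : strict_partition -> series)
  (a : strict_partition -> strict_partition -> strict_partition -> int).
Hypothesis G_tail : forall la m k, G la m != 0 -> (sumn (drop k la) <= mtail k m)%N.
Hypothesis G_diag : forall la, G la (mseq la) != 0.
Hypothesis G_nil : G sp_nil = sone.
Hypothesis J_head : forall la w k, J la (mseq w) != 0 ->
  (sumn (take k w) <= sumn (take k la))%N.
Hypothesis J_size : forall la w, J la (mseq w) != 0 -> (size la <= size w)%N.
Hypothesis J_diag : forall la, J la (mseq la) != 0.
Hypothesis aP : structure_constants G a.
Hypothesis gP : cauchy_dual G g.
Hypothesis omegaP : forall la, omega (skew_dual a g la sp_nil) = J la.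
Implicit Types (la mu nu : strict_partition) (m n : monom) (w : seq nat).

Lemma G_mem la m d : G la m != 0 -> (mdeg m <= d)%N -> la \in SP d.
Proof.
by move=> /(G_tail 0); rewrite drop0 mem_SP; apply: leq_trans.
Qed.

(** [G la] has no terms of degree below [|la|], so every cutoff from [mdeg m] on gives the same
    sum. *)
Lemma sum_G_widen (F : strict_partition -> Zbeta) m d d' :
  (mdeg m <= d)%N -> (mdeg m <= d')%N ->
  \sum_(la <- SP d) F la * G la m = \sum_(la <- SP d') F la * G la m.
Proof.
wlog dd' : d d' / (d <= d')%N.
  by move=> h md md'; case: (leqP d d') => dd'; [|apply/esym]; apply: h => //; apply: ltnW.
move=> md md'; rewrite [RHS](bigID (mem (SP d))) /= [X in _ + X]big1 ?addr0; last first.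
  move=> la lad; have [->|/G_mem-/(_ d md)] := eqVneq (G la m) 0; first by rewrite mulr0.
  by rewrite (negPf lad).
rewrite -[RHS]big_filter; apply: perm_big; apply: uniq_perm.
- exact: SP_uniq.
- by rewrite filter_uniq ?SP_uniq.
by move=> la; rewrite mem_filter /= !mem_SP; apply/esym/andb_idr => /leq_trans; apply.
Qed.

Lemma fsum_G (F : strict_partition -> Zbeta) m d : (mdeg m <= d)%N ->
  \sum_(la \in [set: strict_partition]) F la * G la m =
  \sum_(la <- SP d) F la * G la m.
Proof.
move=> md; rewrite (@fsum_seq _ _ _ (SP d)) ?SP_uniq//.
  by apply: eq_bigl => la; rewrite in_setT.
move=> la _; rewrite mulf_eq0 negb_or => /andP[_ Gla]; exact: G_mem md.
Qed.

Lemma G_free (F : strict_partition -> Zbeta) d :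
  (forall m, (mdeg m <= d)%N -> \sum_(la <- SP d) F la * G la m = 0) ->
  forall la, (sumn la <= d)%N -> F la = 0.
Proof.
move=> h la sl; have ld : la \in SP d by rewrite mem_SP.
apply: (@triangular_free _ _ (SP d) (fun x y => G x (mseq y))
  (fun s : strict_partition => tail_rank s) F xpredT (SP_uniq d) _ G_diag _ la ld isT).
  move=> x y _ _ _ xy nxy; apply: tail_rank_lt => [k|].
    by have := G_tail k xy; rewrite mtail_seq.
  apply: contrapT => /forallNP e; move/eqP: nxy; apply; apply: sp_ext => i.
  by apply: contrapT => /e.
by move=> y; rewrite mem_SP => sy _; apply: h; rewrite mdeg_seq.
Qed.

Definition coef la mu nu : Zbeta :=
  (a la mu nu)%:~R * beta ^+ (sumn la - sumn mu - sumn nu).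

Lemma smul_G mu nu m d : (mdeg m <= d)%N ->
  smul (G mu) (G nu) m = \sum_(la <- SP d) coef la mu nu * G la m.
Proof. by move=> md; rewrite aP -(fsum_G _ md). Qed.

(** [G sp_nil] is the unit, so [G nu] has two expansions, and [G_free] compares their
    coefficients. *)
Lemma coef_nil la nu : coef la sp_nil nu = (la == nu)%:R.
Proof.
apply/eqP; rewrite -subr_eq0; apply/eqP.
apply: (@G_free (fun la => coef la sp_nil nu - (la == nu)%:R) (sumn la)) => // m md.
under eq_bigr do rewrite mulrBl.
rewrite sumrB -smul_G// G_nil smul1; apply/eqP; rewrite subr_eq0; apply/eqP.
have [G0|Gn] := eqVneq (G nu m) 0.
  by rewrite G0 big1// => ka _; case: eqP => [->|]; rewrite ?G0 ?mulr0 ?mul0r.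
rewrite (bigD1_seq nu) ?SP_uniq//=; last exact: G_mem md.
by rewrite eqxx mul1r big1 ?addr0// => ka /negPf->; rewrite mul0r.
Qed.

Lemma skew_nil la : skew_dual a g la sp_nil = g la.
Proof.
apply/funext => m; rewrite /skew_dual.
transitivity (\sum_(nu \in [set: strict_partition]) (la == nu)%:R * g nu m).
  by apply: eq_fsbigr => nu _; rewrite -/(coef la sp_nil nu) coef_nil.
rewrite (@fsum_seq _ _ _ [:: la])//; last first.
  by move=> nu _; apply: contraNT; rewrite inE eq_sym => /negPf->; rewrite mul0r.
by rewrite big_cons big_nil in_setT eqxx mul1r addr0.
Qed.

(** [omega] returns 0 off the span of the Schur functions; since [J la] is nonzero, [g la] lies in
    the span and the value is genuine. *)
Lemma omega_graph_gJ la : omega_graph (g la) (J la).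
Proof.
have := omegaP la; rewrite skew_nil /omega => <-.
apply: contrapT => nex; have [x|] := pselect (exists x, omega_graph (g la) x).
  by apply: nex; apply: (@xgetPex _ _ [set g0 | omega_graph (g la) g0]).
move=> nx; have := omegaP la; rewrite skew_nil /omega xgetPN.
  by move=> e; have := J_diag la; rewrite -e eqxx.
by move=> x /= hx; apply: nx; exists x.
Qed.

Lemma expansion_exists : exists C : strict_partition -> int_partition -> Zbeta,
  forall la, g la = pairS (C la) /\ J la = pairS' (C la).
Proof.
have h la : exists c, g la = pairS c /\ J la = pairS' c.
  exact/omega_graph_pair/omega_graph_gJ.
by have [C CP] := boolp.choice h; exists C.
Qed.

(** The cutoff at [mdeg m] is harmless because [G la m] vanishes for larger [la]. *)
Definition W m n : Zbeta := \sum_(la <- SP (mdeg m)) J la n * G la m.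

(** * Transfer of multiplicativity from the kernel to [W] *)

Section Coefficients.
(** [cm m rho] is the coefficient at [x^m] of the series [c_rho(x)], shared by the kernel and, after
    transposition, by [W]. *)
Variable cm : monom -> int_partition -> Zbeta.
Hypothesis cmK : forall m n, kernel m n = pairS (cm m) n.
Hypothesis cmW : forall m n, W m n = pairS' (cm m) n.

Let gk k : series := kernel^~ (msingle 0 k).

(** A Schur expansion in [y] is symmetric, so this factor depends on the exponent [k] and not on the
    choice of [y_N]. *)
Lemma kernel_single m N k : kernel m (msingle N k) = gk k m.
Proof.
have E M : msingle M k = madd mzero (msingle M k).
  by apply/fsfunP => i; rewrite maddE mzeroE.
rewrite /gk !cmK (E N) (E 0%N) !pairS_add// => i; by rewrite mzeroE.
Qed.

(** Adding [y_N^k] multiplies the kernel by [gk k] and applies [hop k] to its Schur coefficients,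
    and these coefficients are unique. *)
Lemma hop_cm k m rho : hop k (cm m) rho = smul (gk k) (cm^~ rho) m.
Proof.
apply: (@pairS_inj _ (fun rho => smul (gk k) (cm^~ rho) m)) => w.
rewrite -(pairS_add _ _ (@mseq_out w)) -cmK kernel_add ?mseq_out//.
rewrite (_ : kernel^~ (msingle _ k) = gk k); last first.
  by apply/funext => m'; apply: kernel_single.
rewrite /pairS -smul_lin; congr (smul _ _ m).
by apply/funext => m'; apply: cmK.
Qed.

Lemma eop_smul i f m tau :
  eop i (fun rho => smul f (cm^~ rho) m) tau = smul f (fun m => eop i (cm m) tau) m.
Proof.
rewrite /eop smulE; under eq_bigr do rewrite smulE.
by rewrite exchange_big /=; apply: eq_bigr => d _; rewrite mulr_sumr.
Qed.

(* [E(-t) H(t) = 1] turns multiplication by [gk] under [hop] into multiplication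
   by the inverse power series under [eop]. *)
Lemma eop_cm k : exists f, forall m tau, eop k (cm m) tau = smul f (cm^~ tau) m.
Proof.
elim/ltn_ind: k => k IHk; case: (posnP k) => [->|k0].
  by exists sone => m tau; rewrite eop0 smul1.
(* The choice of [f] must be total; [sone] is a filler for [i >= k]. *)
have ex i : exists f, (i < k)%N -> forall m tau, eop i (cm m) tau = smul f (cm^~ tau) m.
  by case: (ltnP i k) => [/IHk[f fP]|_]; [exists f|exists sone].
have [f fP] := boolp.choice ex.
(* This is [strip_inversion] solved for its last term, [i = k]. *)
exists (fun m => \sum_(i < k) - ((-1) ^+ k * (-1) ^+ i) * smul (gk (k - i)) (f i) m) => m tau.
have := strip_inversion (cm m) tau k0; rewrite big_ord_recr /= subnn.
rewrite (eop_ext _ _ (hop0 (cm m))) => /eqP; rewrite addrC addr_eq0 => /eqP e.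
have -> : eop k (cm m) tau = (-1) ^+ k * ((-1) ^+ k * eop k (cm m) tau).
  by rewrite mulrA -expr2 sqrr_sign mul1r.
rewrite e smulC smul_sumr mulrN mulr_sumr -sumrN; apply: eq_bigr => i _.
rewrite (eop_ext _ _ (hop_cm (k - i) m)) eop_smul mulNr mulrA; congr (- (_ * _)).
rewrite [in RHS]smulC -smulA; congr (smul _ _ m).
by apply/funext => m'; rewrite fP.
Qed.

(** The factor [f] depends on the exponent [k] alone and is the same for every [w]; multiplicativity
    of [W] follows from this. *)
Lemma W_rcons k : exists f, forall w,
  W^~ (mseq (rcons w k)) = smul f (W^~ (mseq w)).
Proof.
have [f fP] := eop_cm k; exists f => w; apply/funext => m.
rewrite cmW mseq_rcons (pairS'_add _ _ (@mseq_out w)) /pairS'.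
under eq_bigr do rewrite fP.
rewrite -smul_lin; congr (smul _ _ m).
by apply/funext => m'; rewrite cmW.
Qed.

Lemma W_cat w1 w2 :
  W^~ (mseq (w1 ++ w2)) = smul (W^~ (mseq w1)) (W^~ (mseq w2)).
Proof.
elim/last_ind: w2 => [|w2 k IHw].
  rewrite cats0 (_ : W^~ (mseq [::]) = sone) ?(smulC _ sone) ?smul1//.
  by apply/funext => m; rewrite mseq_nil cmW pairS0 -cmK kernel0.
have [f fP] := W_rcons k.
by rewrite -rcons_cat !fP IHw smulCA.
Qed.

End Coefficients.

Lemma W_mul w1 w2 :
  W^~ (mseq (w1 ++ w2)) = smul (W^~ (mseq w1)) (W^~ (mseq w2)).
Proof.
have [C CP] := expansion_exists.
(* These coefficients come from the Schur expansion of each [g la], which is at the same time the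
   transposed expansion of [J la]. *)
apply: (@W_cat (fun m rho => \sum_(la <- SP (mdeg m)) C la rho * G la m)) => m n.
  rewrite -gP; transitivity (\sum_(la \in [set: strict_partition]) g la n * G la m).
    by apply: eq_fsbigr => la _; rewrite mulrC.
  rewrite (fsum_G _ (leqnn _)) /pairS.
  under [RHS]eq_bigr do rewrite mulr_suml.
  rewrite exchange_big /=; apply: eq_bigr => la _; rewrite (CP la).1 /pairS mulr_suml.
  by apply: eq_bigr => rho _; rewrite mulrAC.
rewrite /W /pairS'; under [RHS]eq_bigr do rewrite mulr_suml.
rewrite exchange_big /=; apply: eq_bigr => la _; rewrite (CP la).2 /pairS' mulr_suml.
by apply: eq_bigr => rho _; rewrite mulrAC.
Qed.

(** The coproduct dual to the product of the [G la]: it is read off as the coefficient of [G la] in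
    [W_mul], once products are expanded by the structure constants. *)
Lemma J_cat la d w1 w2 : (sumn la <= d)%N ->
  J la (mseq (w1 ++ w2)) =
  \sum_(mu <- SP d) (\sum_(nu <- SP d) coef la mu nu * J nu (mseq w2)) * J mu (mseq w1).
Proof.
move=> ld; apply/eqP; rewrite -subr_eq0; apply/eqP.
apply: (@G_free (fun la => J la (mseq (w1 ++ w2)) - \sum_(mu <- SP d)
  (\sum_(nu <- SP d) coef la mu nu * J nu (mseq w2)) * J mu (mseq w1)) d) => // m md.
under eq_bigr do rewrite mulrBl.
rewrite sumrB (sum_G_widen _ md (leqnn _)) -/(W m _) (congr1 (fun f => f m) (W_mul w1 w2)).
apply/eqP; rewrite subr_eq0; apply/eqP.
(* The cutoff in [W] varies with the divisor of [m]; [sum_G_widen] replaces it by the uniform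
   [d]. *)
rewrite (_ : smul _ _ m = smul (fun m => \sum_(mu <- SP d) J mu (mseq w1) * G mu m)
   (fun m => \sum_(nu <- SP d) J nu (mseq w2) * G nu m) m); last first.
  rewrite !smulE big_seq [RHS]big_seq; apply: eq_bigr => e em.
  have := mdeg_div em; rewrite /W => em'.
  by congr (_ * _); apply: sum_G_widen; lia.
rewrite smul_sumr.
under eq_bigr do rewrite smulC smul_sumr mulr_sumr.
rewrite exchange_big /=.
under [RHS]eq_bigr do rewrite mulr_suml.
rewrite [RHS]exchange_big /=; apply: eq_bigr => mu _.
transitivity (\sum_(nu <- SP d) \sum_(la' <- SP d)
    coef la' mu nu * J nu (mseq w2) * J mu (mseq w1) * G la' m).
  apply: eq_bigr => nu _; rewrite smulC (smul_G _ _ md) mulrA mulr_sumr.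
  by apply: eq_bigr => la' _; rewrite mulrCA !mulrA.
by rewrite exchange_big /=; apply: eq_bigr => la' _; rewrite !mulr_suml.
Qed.

(** Triangularity now runs along head sums: [J_size] keeps partitions with more than [p] parts out
    of the equations used, and [J_head] orders the others. *)
Lemma J_free (F : strict_partition -> Zbeta) d p :
  (forall w, size w = p -> \sum_(mu <- SP d) F mu * J mu (mseq w) = 0) ->
  forall mu, (sumn mu <= d)%N -> (size mu <= p)%N -> F mu = 0.
Proof.
move=> h mu sm mp; have md : mu \in SP d by rewrite mem_SP.
(* Head sums grow where the rank must fall, so the rank is [p.+1 * d - hd s]; by [hd_le] the
   subtraction never truncates. *)
pose hd (s : seq nat) := (\sum_(0 <= k < p.+1) sumn (take k s))%N.
have hd_le (s : seq nat) : (sumn s <= d)%N -> (hd s <= p.+1 * d)%N.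
  move=> sd; rewrite /hd -[X in (_ <= X * _)%N]subn0 -sum_nat_const_nat.
  apply: leq_sum => k _; apply: leq_trans sd.
  by rewrite -{2}(cat_take_drop k s) sumn_cat leq_addr.
apply: (@triangular_free _ _ (SP d) (fun x y => J x (mseq y))
  (fun s : strict_partition => p.+1 * d - hd s)%N F (fun y => size y <= p)%N
  (SP_uniq d) _ J_diag _ mu md mp).
  move=> x y; rewrite !mem_SP => xd yd yp Jxy nxy.
  have xp : (size x <= p)%N := leq_trans (J_size Jxy) yp.
  rewrite xp /=; suff : (hd y < hd x)%N.
    by have := hd_le _ xd; have := hd_le _ yd; lia.
  rewrite ltnNge; apply: contra nxy => xy; apply/eqP/sp_ext => i.
  have tE k : (k < p.+1)%N -> sumn (take k x) = sumn (take k y).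
    move=> kp; have : (hd x == hd y)%N.
      by rewrite eqn_leq xy; apply: leq_sum => j _; apply: J_head.
    rewrite /hd (bigD1_seq k) ?iota_uniq ?mem_index_iota//=.
    rewrite [X in _ == X](bigD1_seq k) ?iota_uniq ?mem_index_iota//=.
    have := J_head k Jxy.
    have := @leq_sum _ (index_iota 0 p.+1) (fun i => i != k) _ _ (fun k _ => J_head k Jxy).
    by move=> /=; lia.
  have nthE (s : seq nat) : (i < p)%N -> (size s <= p)%N ->
      (sumn (take i s) + nth 0 s i = sumn (take i.+1 s))%N.
    move=> ip sp; have [il|si] := ltnP i (size s).
      by rewrite (take_nth 0%N il) sumn_rcons.
    by rewrite nth_default// !take_oversize ?addn0// ltnW.
  have [ip|pi] := ltnP i p; last by rewrite !nth_default//; lia.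
  have := nthE x ip xp; have := nthE y ip yp.
  by rewrite !tE//; [lia|lia].
(* Trailing zeros bring the exponent list to length exactly [p] without changing the monomial. *)
move=> y _ yp; rewrite (_ : mseq y = mseq (y ++ nseq (p - size y) 0%N)); last first.
  apply/fsfunP => i; rewrite !mseqE nth_cat nth_nseq; case: ltnP => // yi.
  by rewrite nth_default//; case: ifP.
by apply: h; rewrite size_cat size_nseq subnKC.
Qed.

Lemma structure_constants_eq0 la mu nu :
  (size mu + size nu < size la)%N -> a la mu nu = 0.
Proof.
move=> sz; pose d := (sumn la + sumn mu + sumn nu)%N.
apply: (@mulr_betaX_eq0 _ (sumn la - sumn mu - sumn nu)).
(* [J_free] is applied twice: in [size nu] variables to isolate [nu], then in [size mu] variables to
   isolate [mu]. What remains is [J la] in fewer than [size la] variables. *)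
apply: (@J_free (coef la mu) d (size nu)); rewrite ?/d//; last lia.
move=> w2 s2.
apply: (@J_free (fun mu => \sum_(nu <- SP d) coef la mu nu * J nu (mseq w2)) d (size mu));
  rewrite ?/d//; last lia.
move=> w1 s1; rewrite -J_cat ?/d; last lia.
apply/eqP; apply: contraTT sz => /J_size; rewrite size_cat s1 s2 -leqNgt.
by [].
Qed.

End Duality.

Lemma part_sub_nil la : part_sub sp_nil la.
Proof. by move=> i _; rewrite /part nth_nil. Qed.

Theorem theorem7p8 :
  (forall (a : strict_partition -> strict_partition -> strict_partition -> int)
      (gq : strict_partition -> series),
    structure_constants GP a ->
    cauchy_dual GP gq ->
    (forall la mu : strict_partition, part_sub mu la ->
      omega (skew_dual a gq la mu) = bar_series (ShBTQ la mu) la mu) ->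
    forall la mu nu : strict_partition,
      (size mu + size nu < size la)%N -> a la mu nu = 0)
  /\
  (forall (b : strict_partition -> strict_partition -> strict_partition -> int)
      (gp : strict_partition -> series),
    structure_constants GQ b ->
    cauchy_dual GQ gp ->
    (forall la mu : strict_partition, part_sub mu la ->
      omega (skew_dual b gp la mu) = bar_series (ShBTP la mu) la mu) ->
    forall la mu nu : strict_partition,
      (size mu + size nu < size la)%N -> b la mu nu = 0).
Proof.
split=> a g aP gP omegaP la mu nu.
  (* The types are crossed by duality: [GP] is paired with bar tableaux of type Q, and [GQ] with
     those of type P. *)
  apply: (@structure_constants_eq0 GP (fun la => bar_series (ShBTQ la sp_nil) la sp_nil)
    g a GP_tail GP_diag GP_nil _ _ bar_diagQ aP gP).
  - by move=> ka w k /fsum_ex[T [? ?]]; apply: (@bar_head ka T).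
  - by move=> ka w /fsum_ex[T [? ?]]; apply: (@bar_size ka T).
  - by move=> ka; apply/omegaP/part_sub_nil.
apply: (@structure_constants_eq0 GQ (fun la => bar_series (ShBTP la sp_nil) la sp_nil)
  g a GQ_tail GQ_diag GQ_nil _ _ bar_diagP aP gP).
- by move=> ka w k /fsum_ex[T [[? _] ?]]; apply: (@bar_head ka T).
- by move=> ka w /fsum_ex[T [[? _] ?]]; apply: (@bar_size ka T).
- by move=> ka; apply/omegaP/part_sub_nil.
Qed.
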